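(* Let $\chi_1$ and $\chi_2$ be non-principal even primitive Dirichlet characters modulo $p$ and $q$ respectively, and let $a,x>0$ with $\frac{a^2 pq x}{16 \pi^2}\notin\mathbb{Z}_{>0}$. Then \begin{align*} \sum_{n=1}^\infty d_{\chi_1,\chi_2}(n) K_0(a\sqrt{nx})= \frac{a^2pq\, x}{32 \pi^4} \tau( \chi _1)\tau(\chi_2) \sum_{n=1}^\infty d_{\bar{\chi}_1,\bar{\chi}_2}(n) \frac{\log \left(\frac{16\pi^2 n}{a^2pqx} \right) }{n^2-\left(\frac{a^2pqx}{16\pi^2 } \right)^2}. \end{align*}
   Context: $d_{\chi_1,\chi_2}(n)=\sum_{d\mid n}\chi_1(d)\chi_2(n/d)$. $\tau(\chi)=\sum_{h=1}^q\chi(h)e^{2\pi i h/q}$ is the Gauss sum, and $K_0$ the modified Bessel function of the second kind of order $0$. *)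

(* Defs.v *)
From Stdlib Require Import Reals Lra Lia Arith.
From Coquelicot Require Import Coquelicot.
Open Scope R_scope.

(* A Dirichlet character modulo q (values in C, argument in nat; chi(-1) = chi(q-1)). *)
Definition dirichlet_char (q : nat) (chi : nat -> C) : Prop :=
  (1 <= q)%nat /\
  chi 1%nat = RtoC 1 /\
  (forall m n : nat, chi (m * n)%nat = (chi m * chi n)%C) /\
  (forall n : nat, chi (n + q)%nat = chi n) /\
  (forall n : nat, Nat.gcd n q <> 1%nat -> chi n = (RtoC 0)).

Definition principal (q : nat) (chi : nat -> C) : Prop :=
  forall n : nat, Nat.gcd n q = 1%nat -> chi n = RtoC 1.

Definition induced_modulus (q d : nat) (chi : nat -> C) : Prop :=
  forall n : nat, Nat.gcd n q = 1%nat -> n mod d = 1 mod d -> chi n = RtoC 1.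

Definition primitive_char (q : nat) (chi : nat -> C) : Prop :=
  dirichlet_char q chi /\
  forall d : nat, (1 <= d)%nat -> Nat.divide d q -> (d < q)%nat ->
    ~ induced_modulus q d chi.

(* even: chi(-1) = 1, with -1 represented by q - 1 *)
Definition even_char (q : nat) (chi : nat -> C) : Prop := chi (q - 1)%nat = RtoC 1.

Definition cexp_i (theta : R) : C := (cos theta, sin theta).

Definition gauss_sum (q : nat) (chi : nat -> C) : C :=
  sum_n_m (fun h : nat => (chi h * cexp_i (2 * PI * INR h / INR q))%C) 1 q.

Definition dchi (chi1 chi2 : nat -> C) (n : nat) : C :=
  sum_n_m (fun d : nat =>
             if Nat.eqb (n mod d) 0 then (chi1 d * chi2 (Nat.div n d))%C else (RtoC 0)) 1 n.

Definition conj_char (chi : nat -> C) : nat -> C := fun n => Cconj (chi n).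

(* Modified Bessel function of the second kind of order 0, for x > 0:
   K_0(x) = int_0^oo exp(-x cosh t) dt *)
Definition K0 (x : R) : R :=
  RInt_gen (fun t => exp (- x * cosh t)) (at_point 0) (Rbar_locally p_infty).

(* Main.v *)
(** Put c = a sqrt x / 2.  Both terms are integrals over the real line:
    2 K_0(2c sqrt(mn)) is the integral of exp(-c m e^u) exp(-c n e^(-u)) du, and
    up to constants log(mn/beta) / ((mn)^2 - beta^2) is the integral of
    U(c e^u, m/p) U(c e^(-u), n/q) du with U(y, v) = 2y / (y^2 + 4 pi^2 v^2).
    Summed over m against an even primitive character the two kernels agree:
    sum chi(m) e^(-my) = (tau(chi)/q) sum conj(chi(k)) U(y, k/q).  This comes from
    the partial fractions of the Poisson kernel sinh y / (cosh y - cos 2 pi v),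
    proved by a Herglotz argument (both sides satisfy the same duplication formula
    and differ by O(y) as y -> 0), and from the twisted Gauss sum.
    The products of the kernels are O((mn)^(-3/2)) times an integrable weight in u,
    so truncating both double sums to mn <= N costs o(1) after integration.  The
    truncated integrals are the partial sums of the two series, which therefore
    converge, with the stated relation between their limits. *)

Require Import Defs.
From Stdlib Require Import Reals Lra Lia Arith List Permutation Classical.
From Coquelicot Require Import Coquelicot.
Open Scope R_scope.

(** * Finite complex sums *)

(** Translating u by s multiplies m by e^s and n by e^(-s) in both kernels, so each integral depends
    only on the product mn. This is why divisor sums appear. The obstacle is exchanging infinite
    sums with the integral. The product of the two full sums, [P] in [line_integral_limits], is
    never integrated: the truncations mn <= N are finite sums of explicit integrals, and two
    truncations are compared pointwise through [P], up to a small multiple of the weight 1 /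
    (e^(u/2) + e^(-u/2)). The exponent 3/2 is a compromise. The same power bound in both variables
    leaves no decay in u, because e^u and e^(-u) cancel. So a stronger bound in one variable is
    paired with a weaker one in the other, and the roles are exchanged for the other end of the
    line. Each pairing leaves a factor e^(u/2) or e^(-u/2) and a power of at least 3/2 > 1 in m and
    in n. *)

Fixpoint csum (f : nat -> C) (n : nat) : C :=
  match n with O => RtoC 0 | S k => (csum f k + f k)%C end.

Lemma sum_n_m_csum (f : nat -> C) (n : nat) :
  sum_n_m f 1 n = csum (fun i => f (S i)) n.
Proof.
induction n as [|n IH].
- now rewrite sum_n_m_zero by lia.
- rewrite sum_n_Sm by lia. simpl csum. now rewrite <- IH.
Qed.

Lemma sum_n_csum (f : nat -> C) (n : nat) :
  @sum_n C_AbelianMonoid f n = csum f (S n).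
Proof.
induction n as [|n IH].
- rewrite sum_O. simpl. now rewrite Cplus_0_l.
- rewrite sum_Sn, IH. reflexivity.
Qed.

Lemma csum_ext (f g : nat -> C) (n : nat) :
  (forall i, (i < n)%nat -> f i = g i) -> csum f n = csum g n.
Proof.
induction n as [|n IH]; intros H; simpl; [reflexivity|].
rewrite IH by (intros; apply H; lia). rewrite H by lia. reflexivity.
Qed.

Lemma csum_plus (f g : nat -> C) (n : nat) :
  csum (fun i => f i + g i)%C n = (csum f n + csum g n)%C.
Proof. induction n as [|n IH]; simpl; [ring | rewrite IH; ring]. Qed.

Lemma csum_mult_l (c : C) (f : nat -> C) (n : nat) :
  csum (fun i => c * f i)%C n = (c * csum f n)%C.
Proof. induction n as [|n IH]; simpl; [ring | rewrite IH; ring]. Qed.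

Lemma csum_mult_r (c : C) (f : nat -> C) (n : nat) :
  csum (fun i => f i * c)%C n = (csum f n * c)%C.
Proof. induction n as [|n IH]; simpl; [ring | rewrite IH; ring]. Qed.

Lemma csum_minus (f g : nat -> C) (n : nat) :
  csum (fun i => f i - g i)%C n = (csum f n - csum g n)%C.
Proof. induction n as [|n IH]; simpl; [ring | rewrite IH; ring]. Qed.

Lemma csum_0 (f : nat -> C) (n : nat) :
  (forall i, (i < n)%nat -> f i = RtoC 0) -> csum f n = RtoC 0.
Proof.
induction n as [|n IH]; intros H; simpl; [reflexivity|].
rewrite IH by (intros; apply H; lia). rewrite H by lia. ring.
Qed.

Lemma csum_single (f : nat -> C) (n k : nat) :
  (k < n)%nat -> (forall i, (i < n)%nat -> i <> k -> f i = RtoC 0) ->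
  csum f n = f k.
Proof.
induction n as [|n IH]; intros Hk H; [lia|]. simpl.
destruct (Nat.eq_dec k n) as [->|Hn].
- rewrite csum_0 by (intros; apply H; lia). ring.
- rewrite IH by (try lia; intros; apply H; lia). rewrite (H n) by lia. ring.
Qed.

Lemma csum_swap (F : nat -> nat -> C) (m n : nat) :
  csum (fun i => csum (F i) n) m = csum (fun j => csum (fun i => F i j) m) n.
Proof.
induction m as [|m IH]; simpl.
- now rewrite csum_0.
- now rewrite IH, <- csum_plus.
Qed.

Lemma csum_add (f : nat -> C) (m n : nat) :
  csum f (m + n) = (csum f m + csum (fun i => f (m + i)%nat) n)%C.
Proof.
induction n as [|n IH].
- rewrite Nat.add_0_r. simpl. ring.
- rewrite Nat.add_succ_r. simpl. rewrite IH. ring.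
Qed.

Lemma csum_extend (f : nat -> C) (n m : nat) :
  (n <= m)%nat -> (forall i, (n <= i < m)%nat -> f i = RtoC 0) ->
  csum f m = csum f n.
Proof.
intros H Hf. replace m with (n + (m - n))%nat by lia.
rewrite csum_add, (csum_0 _ (m - n)) by (intros; apply Hf; lia). ring.
Qed.

Lemma csum_succ_l (f : nat -> C) (n : nat) :
  csum f (S n) = (f 0%nat + csum (fun i => f (S i)) n)%C.
Proof. change (S n) with (1 + n)%nat. rewrite csum_add. simpl. ring. Qed.

Lemma csum_rev (f : nat -> C) (n : nat) :
  csum f n = csum (fun i => f (n - 1 - i)%nat) n.
Proof.
induction n as [|n IH]; [reflexivity|].
rewrite (csum_succ_l (fun i => f (S n - 1 - i)%nat)).
change (csum f (S n)) with (csum f n + f n)%C. rewrite IH.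
replace (S n - 1 - 0)%nat with n by lia.
rewrite (csum_ext _ (fun i => f (S n - 1 - S i)%nat)).
- ring.
- intros i Hi. f_equal. lia.
Qed.

(** Euclidean division of the index groups [k] full periods by residue; a function of period [q]
    then leaves the sum over [j]. *)
Lemma csum_mul (f : nat -> C) (q k : nat) :
  csum f (q * k) = csum (fun j => csum (fun h => f (j * q + h)%nat) q) k.
Proof.
induction k as [|k IH].
- now rewrite Nat.mul_0_r.
- rewrite Nat.mul_succ_r, csum_add, IH. simpl. f_equal.
  apply csum_ext; intros. f_equal. lia.
Qed.

Lemma csum_conj (f : nat -> C) (n : nat) :
  Cconj (csum f n) = csum (fun i => Cconj (f i)) n.
Proof.
induction n as [|n IH]; simpl.
- unfold Cconj, RtoC; simpl; f_equal; ring.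
- now rewrite Cplus_conj, IH.
Qed.

Lemma csum_list (f : nat -> C) (n : nat) :
  csum f n = fold_right Cplus (RtoC 0) (map f (seq 0 n)).
Proof.
assert (H : forall s, csum (fun i => f (s + i)%nat) n
                      = fold_right Cplus (RtoC 0) (map f (seq s n))).
{ induction n as [|n IH]; intros s; [reflexivity|].
  rewrite csum_succ_l. simpl. rewrite Nat.add_0_r. f_equal.
  rewrite <- IH. apply csum_ext. intros; f_equal; lia. }
exact (H 0%nat).
Qed.

Lemma csum_permutation (f : nat -> C) (l l' : list nat) :
  Permutation l l' ->
  fold_right Cplus (RtoC 0) (map f l) = fold_right Cplus (RtoC 0) (map f l').
Proof.
induction 1; simpl; [reflexivity | now f_equal | ring | congruence].
Qed.

Lemma mul_mod_permutation (q n : nat) :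
  (1 <= q)%nat -> Nat.gcd n q = 1%nat ->
  Permutation (map (fun m => (m * n) mod q) (seq 0 q)) (seq 0 q).
Proof.
intros Hq Hg. apply NoDup_Permutation_bis.
- apply NoDup_map_NoDup_ForallPairs; [|apply seq_NoDup].
  (* Injectivity is shown for [a <= b] first, because the natural subtraction [b - a] is faithful
     only in that order. Then [q] divides [n * (b - a)], and Gauss's lemma leaves [b - a = 0]. *)
  assert (Hle : forall a b, In a (seq 0 q) -> In b (seq 0 q) ->
            (a * n) mod q = (b * n) mod q -> (a <= b)%nat -> a = b).
  { intros a b Ha Hb E Hab. apply in_seq in Ha, Hb.
    assert (D : Nat.divide q (n * (b - a))).
    { exists (b * n / q - a * n / q)%nat.
      pose proof (Nat.div_mod (a * n) q ltac:(lia)) as E1.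
      pose proof (Nat.div_mod (b * n) q ltac:(lia)) as E2.
      rewrite Nat.mul_sub_distr_l, Nat.mul_sub_distr_r, (Nat.mul_comm n b), (Nat.mul_comm n a).
      rewrite (Nat.mul_comm (b * n / q)), (Nat.mul_comm (a * n / q)).
      rewrite E1 at 1. rewrite E2 at 1. rewrite E. lia. }
    apply Nat.gauss in D; [|now rewrite Nat.gcd_comm].
    destruct (Nat.eq_dec (b - a) 0); [lia|].
    apply Nat.divide_pos_le in D; lia. }
  intros a b Ha Hb E. destruct (Nat.le_ge_cases a b) as [H|H].
  + now apply Hle.
  + symmetry. now apply Hle.
- now rewrite length_map.
- intros m Hm. apply in_map_iff in Hm. destruct Hm as [k [<- _]].
  apply in_seq. pose proof (Nat.mod_upper_bound (k * n) q). lia.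
Qed.

Lemma periodic_mod (q : nat) (G : nat -> C) :
  (1 <= q)%nat -> (forall n, G (n + q)%nat = G n) ->
  forall n, G (n mod q) = G n.
Proof.
intros Hq HG n. rewrite (Nat.div_mod n q) at 2 by lia.
generalize (n / q)%nat as k. induction k as [|k IH].
- now rewrite Nat.mul_0_r.
- rewrite IH, <- HG. f_equal. lia.
Qed.

Lemma csum_mul_coprime (q n : nat) (G : nat -> C) :
  (1 <= q)%nat -> Nat.gcd n q = 1%nat -> (forall m, G (m + q)%nat = G m) ->
  csum (fun m => G (m * n)%nat) q = csum G q.
Proof.
intros Hq Hn HG. rewrite !csum_list.
rewrite <- (csum_permutation G _ _ (mul_mod_permutation q n Hq Hn)), map_map.
f_equal. apply map_ext. intros m. now rewrite (periodic_mod q).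
Qed.

(** * Additive and multiplicative characters *)

Lemma cexp_i_add (s t : R) : cexp_i (s + t) = (cexp_i s * cexp_i t)%C.
Proof.
unfold cexp_i, Cmult; simpl. rewrite cos_plus, sin_plus. f_equal; ring.
Qed.

Lemma cexp_i_nat_period (k : nat) : cexp_i (2 * PI * INR k) = RtoC 1.
Proof.
unfold cexp_i, RtoC.
replace (2 * PI * INR k) with (0 + 2 * INR k * PI) by ring.
now rewrite cos_period, sin_period, cos_0, sin_0.
Qed.

Definition unit_root (q k : nat) : C := cexp_i (2 * PI * INR k / INR q).

Lemma unit_root_add (q j k : nat) :
  unit_root q (j + k) = (unit_root q j * unit_root q k)%C.
Proof.
unfold unit_root. rewrite <- cexp_i_add, plus_INR. f_equal. unfold Rdiv; ring.
Qed.

Lemma unit_root_mul (q k : nat) : (1 <= q)%nat -> unit_root q (k * q) = RtoC 1.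
Proof.
intros Hq. unfold unit_root. rewrite mult_INR, <- (cexp_i_nat_period k). f_equal.
field. apply not_0_INR. lia.
Qed.

Lemma unit_root_0 (q : nat) : unit_root q 0 = RtoC 1.
Proof.
unfold unit_root, cexp_i, RtoC. simpl. unfold Rdiv.
now rewrite Rmult_0_r, Rmult_0_l, cos_0, sin_0.
Qed.

Lemma unit_root_eq_1 (q k : nat) :
  (0 < k < q)%nat -> unit_root q k <> RtoC 1.
Proof.
intros Hk E. unfold unit_root, cexp_i, RtoC in E. injection E as E1 E2.
(* Half the angle lies strictly between 0 and PI, where the sine is positive, so cos 2t = 1 - 2
   sin^2 t is below 1. *)
set (t := PI * INR k / INR q).
assert (Hq : 0 < INR q) by (apply lt_0_INR; lia).
assert (H0 : 0 < INR k) by (apply lt_0_INR; lia).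
assert (H1 : INR k < INR q) by (apply lt_INR; lia).
pose proof PI_RGT_0.
assert (Ht : 0 < t < PI).
{ unfold t. split.
  - apply Rdiv_lt_0_compat; nra.
  - apply Rmult_lt_reg_r with (INR q); [lra|]. unfold Rdiv.
    rewrite Rmult_assoc, Rinv_l by lra. nra. }
pose proof (sin_gt_0 t (proj1 Ht) (proj2 Ht)).
replace (2 * PI * INR k / INR q) with (2 * t) in E1 by (unfold t; field; lra).
rewrite cos_2a_sin in E1. nra.
Qed.

Lemma unit_root_geometric (q k n : nat) :
  ((unit_root q k - 1) * csum (fun h => unit_root q (h * k)) n
   = unit_root q (n * k) - 1)%C.
Proof.
induction n as [|n IH]; simpl csum.
- simpl. rewrite unit_root_0. ring.
- rewrite Cmult_plus_distr_l, IH. simpl Nat.mul. rewrite unit_root_add. ring.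
Qed.

Lemma unit_root_orthogonality (q k : nat) :
  (0 < k < q)%nat -> csum (fun h => unit_root q (h * k)) q = RtoC 0.
Proof.
intros Hk. pose proof (unit_root_geometric q k q) as E.
rewrite Nat.mul_comm, unit_root_mul in E by lia.
destruct (classic (csum (fun h => unit_root q (h * k)) q = RtoC 0)) as [Z|Z];
  [exact Z|exfalso].
apply (Cmult_neq_0 (unit_root q k - 1)%C _) in Z.
- apply Z. rewrite E. ring.
- intros D. apply (unit_root_eq_1 q k Hk).
  replace (unit_root q k) with (unit_root q k - 1 + 1)%C by ring.
  rewrite D. ring.
Qed.

Lemma char_bounded (q : nat) (chi : nat -> C) :
  dirichlet_char q chi -> exists B, forall n, Cmod (chi n) <= B.
Proof.
intros [Hq [_ [_ [Hp _]]]].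
assert (H : forall m, exists B, forall n, (n < m)%nat -> Cmod (chi n) <= B).
{ induction m as [|m [B IH]].
  - exists 0. intros; lia.
  - exists (Rmax B (Cmod (chi m))). intros n Hn.
    destruct (Nat.eq_dec n m) as [->|E]; [apply Rmax_r|].
    eapply Rle_trans; [apply IH; lia|apply Rmax_l]. }
destruct (H q) as [B HB]. exists B. intros n.
rewrite <- (periodic_mod q chi Hq Hp). apply HB, Nat.mod_upper_bound. lia.
Qed.

Lemma char_pow (q : nat) (chi : nat -> C) (n k : nat) :
  dirichlet_char q chi -> chi (n ^ k)%nat = (chi n ^ k)%C.
Proof.
intros [_ [H1 [Hm _]]]. induction k as [|k IH]; simpl.
- exact H1.
- now rewrite Hm, IH.
Qed.

(* The powers of chi n are values of chi, hence bounded. *)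
Lemma char_Cmod_le_1 (q : nat) (chi : nat -> C) (n : nat) :
  dirichlet_char q chi -> Cmod (chi n) <= 1.
Proof.
intros Hc. destruct (char_bounded q chi Hc) as [B HB].
destruct (Rle_lt_dec (Cmod (chi n)) 1) as [H|H]; [exact H|exfalso].
destruct (Pow_x_infinity (Cmod (chi n))
            ltac:(rewrite Rabs_pos_eq; [lra|apply Cmod_ge_0]) (B + 1)) as [N HN].
specialize (HN N (le_n _)).
rewrite <- Cmod_pow, <- (char_pow q) in HN by exact Hc.
rewrite Rabs_pos_eq in HN by apply Cmod_ge_0.
pose proof (HB (n ^ N)%nat). lra.
Qed.

(** Modulo 1 the only character is the constant 1. Non-principality enters here: a modulus above 1
    forces [chi 0 = 0], so the twisted sums carry no constant term. *)
Lemma nonprincipal_gt_1 (q : nat) (chi : nat -> C) :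
  dirichlet_char q chi -> ~ principal q chi -> (1 < q)%nat.
Proof.
intros [Hq [H1 [_ [Hp _]]]] Hn. destruct (Nat.eq_dec q 1) as [->|E]; [|lia].
exfalso. apply Hn. intros n _.
rewrite <- (periodic_mod 1 chi Hq Hp), <- H1, <- (periodic_mod 1 chi Hq Hp 1).
now rewrite !Nat.mod_1_r.
Qed.

Lemma char_add_mul (q : nat) (chi : nat -> C) (n k : nat) :
  dirichlet_char q chi -> chi (n + k * q)%nat = chi n.
Proof.
intros [Hq [_ [_ [Hp _]]]].
rewrite <- (periodic_mod q chi Hq Hp), Nat.Div0.mod_add. now apply periodic_mod.
Qed.

(** A Bezout inverse [m] of [n] modulo [q] gives |chi m| |chi n| = 1, and neither factor exceeds
    1. *)
Lemma char_mul_conj (q : nat) (chi : nat -> C) (n : nat) :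
  dirichlet_char q chi -> (1 < q)%nat -> Nat.gcd n q = 1%nat ->
  (chi n * Cconj (chi n))%C = RtoC 1.
Proof.
intros Hc Hq Hg. rewrite <- Cmod2_conj.
assert (Hn : (0 < n)%nat).
{ destruct n; [|lia]. rewrite Nat.gcd_0_l in Hg. lia. }
destruct (Nat.gcd_bezout_pos n q Hn) as [m [k E]]. rewrite Hg in E.
assert (E' : (chi m * chi n)%C = RtoC 1).
{ pose proof Hc as [_ [H1 [Hm _]]]. rewrite <- Hm, E.
  rewrite (char_add_mul q); [exact H1|exact Hc]. }
apply (f_equal Cmod) in E'. rewrite Cmod_mult, Cmod_1 in E'.
pose proof (char_Cmod_le_1 q chi m Hc). pose proof (char_Cmod_le_1 q chi n Hc).
pose proof (Cmod_ge_0 (chi n)). pose proof (Cmod_ge_0 (chi m)).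
replace (Cmod (chi n)) with 1 by nra. f_equal. ring.
Qed.

Lemma char_0 (q : nat) (chi : nat -> C) :
  dirichlet_char q chi -> (1 < q)%nat -> chi 0%nat = RtoC 0.
Proof. intros [_ [_ [_ [_ H]]]] Hq. apply H. rewrite Nat.gcd_0_l. lia. Qed.

Lemma even_char_reflect (q : nat) (chi : nat -> C) (h : nat) :
  dirichlet_char q chi -> (1 < q)%nat -> even_char q chi -> (h <= q)%nat ->
  chi (q - h)%nat = chi h.
Proof.
intros Hc Hq He Hh. destruct h as [|h].
- rewrite Nat.sub_0_r. rewrite <- (char_add_mul q chi 0 1) by exact Hc.
  f_equal. lia.
- rewrite <- (char_add_mul q chi _ h) by exact Hc.
  (* Adding [h] periods turns -(h + 1) into a genuine multiple of [q - 1], the natural number that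
     stands for -1. *)
  replace (q - S h + h * q)%nat with ((q - 1) * S h)%nat by nia.
  destruct Hc as [_ [_ [Hm _]]]. rewrite Hm, He. ring.
Qed.

(** Reflection sends index 0 to [q], just outside the range, so the two end values must agree. *)
Lemma csum_reflect (f : nat -> C) (q : nat) :
  f 0%nat = f q -> csum (fun m => f (q - m)%nat) q = csum f q.
Proof.
intros E. rewrite csum_rev.
rewrite (csum_ext _ (fun i => f (S i))) by (intros; f_equal; lia).
pose proof (csum_succ_l f q) as H. simpl csum in H. rewrite E in H.
replace (csum (fun i => f (S i)) q) with (f q + csum (fun i => f (S i)) q - f q)%C by ring.
rewrite <- H. ring.
Qed.

Lemma gauss_sum_csum (q : nat) (chi : nat -> C) :
  dirichlet_char q chi ->
  gauss_sum q chi = csum (fun h => chi h * unit_root q h)%C q.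
Proof.
intros Hc. unfold gauss_sum. rewrite sum_n_m_csum.
rewrite <- (csum_reflect (fun h => chi h * unit_root q h)%C q), csum_rev.
- apply csum_ext. intros i Hi. replace (S (q - 1 - i)) with (q - i)%nat by lia. reflexivity.
- f_equal.
  + rewrite <- (char_add_mul q chi 0 1) by exact Hc. f_equal. lia.
  + rewrite unit_root_0. rewrite <- (unit_root_mul q 1) by apply Hc. f_equal. lia.
Qed.

Lemma unit_root_period (q k j : nat) :
  (1 <= q)%nat -> unit_root q (k + j * q) = unit_root q k.
Proof. intros Hq. rewrite unit_root_add, unit_root_mul by exact Hq. ring. Qed.

(** For [k] coprime to [q], substitute m k for m. Otherwise both sides vanish, and this is where
    primitivity is used: the sum X satisfies X = chi(n) X for some n with chi(n) <> 1. *)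
Lemma gauss_sum_twist (q : nat) (chi : nat -> C) (k : nat) :
  primitive_char q chi -> (1 < q)%nat ->
  csum (fun m => chi m * unit_root q (m * k))%C q
  = (Cconj (chi k) * gauss_sum q chi)%C.
Proof.
intros [Hc Hprim] Hq.
pose proof Hc as [Hq1 [H1 [Hm [Hp Hz]]]].
destruct (Nat.eq_dec (Nat.gcd k q) 1) as [Hg|Hg].
- rewrite gauss_sum_csum by exact Hc.
  rewrite <- (csum_mul_coprime q k (fun m => chi m * unit_root q m)%C Hq1 Hg).
  + rewrite <- csum_mult_l. apply csum_ext. intros m _. rewrite Hm.
    pose proof (char_mul_conj q chi k Hc Hq Hg) as E.
    replace (Cconj (chi k) * (chi m * chi k * unit_root q (m * k)))%C
      with ((chi k * Cconj (chi k)) * (chi m * unit_root q (m * k)))%C by ring.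
    rewrite E. ring.
  + intros m. rewrite Hp. f_equal. replace (m + q)%nat with (m + 1 * q)%nat by lia.
    now apply unit_root_period.
- rewrite (Hz k Hg).
  replace (Cconj (RtoC 0)) with (RtoC 0) by (unfold Cconj, RtoC; simpl; f_equal; ring).
  rewrite Cmult_0_l.
  destruct (Nat.gcd_divide k q) as [[k' Ek] [d Ed]].
  set (e := Nat.gcd k q) in *.
  assert (He : (1 < e)%nat) by (destruct e as [|[|e]]; lia).
  assert (Hd : (1 <= d)%nat) by (destruct d; lia).
  (* Here d = q / gcd(k, q) is a proper divisor of [q], so primitivity supplies n coprime to [q],
     congruent to 1 modulo d, with chi(n) <> 1. *)
  assert (Hni : ~ induced_modulus q d chi).
  { apply Hprim; [exact Hd | exists e; lia | nia]. }
  apply not_all_ex_not in Hni. destruct Hni as [n Hn].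
  apply imply_to_and in Hn. destruct Hn as [Hgn Hn].
  apply imply_to_and in Hn. destruct Hn as [Hmod Hne].
  set (X := csum (fun m => chi m * unit_root q (m * k))%C q).
  assert (Hn1 : (1 <= n)%nat).
  { destruct n; [rewrite Nat.gcd_0_l in Hgn|]; lia. }
  (* For [d = 1] the remainder [1 mod d] is 0 and not 1, hence the separate case. *)
  assert (D : exists t, (n = 1 + t * d)%nat).
  { pose proof (Nat.div_mod n d ltac:(lia)) as E.
    destruct (Nat.eq_dec d 1) as [->|Hd1].
    - exists (n - 1)%nat. lia.
    - rewrite (Nat.mod_small 1 d) in Hmod by lia. exists (n / d)%nat. lia. }
  destruct D as [t Et].
  (* Multiplication by [n] permutes the residues and fixes the additive factor: (n - 1) k = t d k' e
     = t k' q is a multiple of [q]. *)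
  assert (E : X = (chi n * X)%C).
  { unfold X at 1.
    rewrite <- (csum_mul_coprime q n (fun m => chi m * unit_root q (m * k))%C Hq1 Hgn).
    - unfold X. rewrite <- csum_mult_l. apply csum_ext. intros m _. rewrite Hm.
      replace (m * n * k)%nat with (m * k + (m * t * k') * q)%nat.
      + rewrite unit_root_period by exact Hq1. ring.
      + rewrite Et, Ed, Ek. ring.
    - intros m. rewrite Hp. f_equal.
      replace ((m + q) * k)%nat with (m * k + k * q)%nat by ring.
      now apply unit_root_period. }
  destruct (classic (X = RtoC 0)) as [Z|Z]; [exact Z|exfalso].
  apply Hne.
  assert (Y : ((1 - chi n) * X)%C = RtoC 0).
  { replace ((1 - chi n) * X)%C with (X - chi n * X)%C by ring. rewrite <- E. ring. }
  destruct (classic ((1 - chi n)%C = RtoC 0)) as [W|W].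
  + replace (chi n) with (1 - (1 - chi n))%C by ring. rewrite W. ring.
  + exfalso. now apply (Cmult_neq_0 _ _ W Z).
Qed.

(** * The Poisson kernel at rational angles *)

(** For y > 0 this is the sum of exp(-y|n|) e(n al) over all integers n, that is (1 - r^2) / (1 - 2
    r cos(2 pi al) + r^2) with r = exp(-y). *)
Definition poisson (y al : R) : R := sinh y / (cosh y - cos (2 * PI * al)).

Lemma cosh_gt_1 (y : R) : 0 < y -> 1 < cosh y.
Proof.
intros Hy. unfold cosh.
assert (H : 1 < exp y) by (rewrite <- exp_0; now apply exp_increasing).
rewrite exp_Ropp.
assert (0 < (exp y - 1) ^ 2 / exp y) by (apply Rdiv_lt_0_compat; [apply pow_lt|]; lra).
replace ((exp y - 1) ^ 2 / exp y) with (exp y + / exp y - 2) in H0 by (field; lra).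
lra.
Qed.

Lemma unit_root_pow (q h m : nat) : unit_root q (m * h) = (unit_root q h ^ m)%C.
Proof.
induction m as [|m IH]; simpl.
- apply unit_root_0.
- now rewrite unit_root_add, IH.
Qed.

Lemma csum_pow (z : C) (n : nat) :
  (csum (fun m => z ^ m) n * (1 - z) = 1 - z ^ n)%C.
Proof.
induction n as [|n IH]; simpl; [ring|].
rewrite Cmult_plus_distr_r, IH. ring.
Qed.

Lemma Re_csum (f : nat -> C) (n : nat) :
  (csum f n + Cconj (csum f n) = RtoC (2 * Re (csum f n)))%C.
Proof.
destruct (csum f n) as [u v]. unfold Cconj, Cplus, RtoC; simpl. f_equal; ring.
Qed.

(* The finite geometric sum of z = r e(h/q), for which z^q = r^q is real,
   combined with poisson = 2 Re (1 / (1 - z)) - 1. *)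
Lemma poisson_csum (y : R) (q h : nat) :
  (1 <= q)%nat -> 0 < y ->
  RtoC ((poisson y (INR h / INR q) + 1) * (1 - exp (- y) ^ q))
  = (csum (fun m => RtoC (exp (- y) ^ m) * unit_root q (m * h)) q
     + csum (fun m => RtoC (exp (- y) ^ m) * Cconj (unit_root q (m * h))) q)%C.
Proof.
intros Hq Hy. set (r := exp (- y)).
set (z := (RtoC r * unit_root q h)%C).
assert (E1 : csum (fun m => RtoC (r ^ m) * unit_root q (m * h))%C q = csum (fun m => z ^ m)%C q).
{ apply csum_ext. intros m _. unfold z. rewrite Cpow_mult_l, <- unit_root_pow. f_equal.
  now rewrite RtoC_pow. }
assert (E2 : csum (fun m => RtoC (r ^ m) * Cconj (unit_root q (m * h)))%C q
             = Cconj (csum (fun m => z ^ m)%C q)).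
{ rewrite <- E1, csum_conj. apply csum_ext. intros m _. rewrite Cmult_conj. f_equal.
  unfold Cconj, RtoC; simpl; f_equal; ring. }
rewrite E1, E2, Re_csum. f_equal.
pose proof (csum_pow z q) as E. set (G := csum (fun m => z ^ m)%C q) in *.
assert (Ez : (z ^ q)%C = RtoC (r ^ q)).
{ unfold z. rewrite Cpow_mult_l, <- unit_root_pow, Nat.mul_comm, unit_root_mul by exact Hq.
  rewrite RtoC_pow. ring. }
rewrite Ez in E.
set (t := 2 * PI * (INR h / INR q)).
assert (Eu : unit_root q h = (cos t, sin t)).
{ unfold unit_root, cexp_i, t. unfold Rdiv. now rewrite !Rmult_assoc. }
unfold z in E. rewrite Eu in E. destruct G as [gx gy].
unfold Cmult, Cminus, Cplus, Copp, RtoC in E; simpl in E. injection E as Ex Ey.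
unfold poisson. fold t.
assert (Hr : 0 < r) by apply exp_pos.
pose proof (cosh_gt_1 y Hy) as Hch. pose proof (COS_bound t) as Hc.
pose proof (sin2_cos2 t) as Hsc. unfold Rsqr in Hsc.
(* Multiplying numerator and denominator of the kernel by 2r gives its usual form in [r]. *)
assert (Ep : sinh y / (cosh y - cos t) * (1 - 2 * r * cos t + r ^ 2) = 1 - r ^ 2).
{ apply Rmult_eq_reg_r with (cosh y - cos t); [|lra].
  unfold Rdiv. rewrite Rmult_assoc, Rmult_comm, <- !Rmult_assoc.
  replace ((1 - 2 * r * cos t + r ^ 2) * (cosh y - cos t) * sinh y * / (cosh y - cos t))
    with ((1 - 2 * r * cos t + r ^ 2) * sinh y) by (field; lra).
  unfold sinh, cosh, r. rewrite exp_Ropp. field. apply Rgt_not_eq, exp_pos. }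
simpl Re.
assert (Hpos : 0 < 1 - 2 * r * cos t + r ^ 2).
{ assert (r < 1) by (unfold r; rewrite <- exp_0; apply exp_increasing; lra). nra. }
set (P := sinh y / (cosh y - cos t)) in *.
apply Rmult_eq_reg_r with (1 - 2 * r * cos t + r ^ 2); [|lra].
replace ((P + 1) * (1 - r ^ q) * (1 - 2 * r * cos t + r ^ 2))
  with ((P * (1 - 2 * r * cos t + r ^ 2) + (1 - 2 * r * cos t + r ^ 2)) * (1 - r ^ q)) by ring.
rewrite Ep.
(* Real part of (1 - z) G = 1 - r^q after multiplication by the conjugate of 1 - z; the imaginary
   part [Ey] eliminates [gy]. *)
assert (Hg : gx * (1 - 2 * r * cos t + r ^ 2) = (1 - r ^ q) * (1 - r * cos t)).
{ replace (1 - r ^ q) with (gx * (1 + - (r * cos t - 0 * sin t)) - gy * (0 + - (r * sin t + 0 * cos t)))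
    by lra.
  assert (gx * (r * sin t) = gy * (1 - r * cos t)) by lra.
  replace (1 - 2 * r * cos t + r ^ 2) with ((1 - r * cos t) * (1 - r * cos t) + (r * sin t) * (r * sin t))
    by (replace (r ^ 2) with (r ^ 2 * (sin t * sin t + cos t * cos t)) by (rewrite Hsc; ring); ring).
  rewrite Rmult_plus_distr_l, <- (Rmult_assoc gx (r * sin t)), H. ring. }
replace (2 * gx * (1 - 2 * r * cos t + r ^ 2)) with (2 * (gx * (1 - 2 * r * cos t + r ^ 2))) by ring.
rewrite Hg. ring.
Qed.

Lemma unit_root_orthogonality_mod (q k : nat) :
  (1 <= q)%nat ->
  csum (fun h => unit_root q (h * k)) q
  = if Nat.eqb (k mod q) 0 then RtoC (INR q) else RtoC 0.
Proof.
intros Hq.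
assert (E : csum (fun h => unit_root q (h * k)) q
            = csum (fun h => unit_root q (h * (k mod q))) q).
{ apply csum_ext. intros h _. rewrite (Nat.div_mod k q) at 1 by lia.
  replace (h * (q * (k / q) + k mod q))%nat with (h * (k mod q) + (h * (k / q)) * q)%nat by ring.
  now apply unit_root_period. }
rewrite E. destruct (Nat.eqb_spec (k mod q) 0) as [H|H].
(* Only the number of terms is generalized; the modulus inside [unit_root] has to stay fixed during
   the induction. *)
- rewrite H. clear. generalize q at 2 3 as n. induction n as [|n IH]; [reflexivity|].
  simpl csum. rewrite IH, S_INR, RtoC_plus, Nat.mul_0_r, unit_root_0. reflexivity.
- apply unit_root_orthogonality. pose proof (Nat.mod_upper_bound k q). lia.
Qed.

(** The index [k * (q - 1)] stands for -k, which keeps exponents natural and makes the orthogonality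
    relation applicable to conjugates. *)
Lemma unit_root_conj (q k : nat) :
  (1 <= q)%nat -> Cconj (unit_root q k) = unit_root q (k * (q - 1)).
Proof.
intros Hq.
assert (E : (unit_root q k * unit_root q (k * (q - 1)))%C = RtoC 1).
{ rewrite <- unit_root_add. replace (k + k * (q - 1))%nat with (k * q)%nat by nia.
  now apply unit_root_mul. }
assert (E' : (Cconj (unit_root q k) * unit_root q k)%C = RtoC 1).
{ unfold unit_root, cexp_i, Cconj, Cmult, RtoC; simpl.
  set (t := 2 * PI * INR k / INR q). pose proof (sin2_cos2 t) as H. unfold Rsqr in H.
  f_equal; lra. }
replace (unit_root q (k * (q - 1)))
  with ((Cconj (unit_root q k) * unit_root q k) * unit_root q (k * (q - 1)))%C
  by (rewrite E'; ring).
rewrite <- Cmult_assoc, E. ring.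
Qed.

(** After the finite geometric sums are inserted, orthogonality keeps only n = q - m in the plain
    sum and n = m in the conjugate one. The constant -1 of the kernel disappears because m is not 0
    modulo q. *)
Lemma poisson_dft (y : R) (q m : nat) :
  (0 < m < q)%nat -> 0 < y ->
  (csum (fun h => unit_root q (m * h) * RtoC (poisson y (INR h / INR q))) q
   * RtoC (1 - exp (- y) ^ q)
   = RtoC (INR q * (exp (- y) ^ m + exp (- y) ^ (q - m))))%C.
Proof.
intros Hm Hy. set (r := exp (- y)).
assert (Hq : (1 <= q)%nat) by lia.
assert (Horth : csum (fun h => unit_root q (m * h)) q = RtoC 0).
{ rewrite <- (unit_root_orthogonality q m Hm). apply csum_ext. intros; f_equal; lia. }
rewrite <- csum_mult_r.
rewrite (csum_ext _ (fun h =>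
   csum (fun n => unit_root q (m * h) * (RtoC (r ^ n) * unit_root q (n * h)))%C q
   + csum (fun n => unit_root q (m * h) * (RtoC (r ^ n) * Cconj (unit_root q (n * h))))%C q
   - unit_root q (m * h) * RtoC (1 - r ^ q))%C).
2:{ intros h _. rewrite !csum_mult_l, <- Cmult_plus_distr_l.
    unfold r. rewrite <- (poisson_csum y q h Hq Hy). fold r.
    rewrite !RtoC_mult, !RtoC_plus. ring. }
rewrite csum_minus, csum_plus, csum_mult_r, Horth.
rewrite (csum_swap (fun h n => unit_root q (m * h) * (RtoC (r ^ n) * unit_root q (n * h)))%C).
rewrite (csum_swap (fun h n => unit_root q (m * h) * (RtoC (r ^ n) * Cconj (unit_root q (n * h))))%C).
rewrite (csum_single _ q (q - m)).
2: lia.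
2:{ intros n Hn Hne.
    rewrite (csum_ext _ (fun h => RtoC (r ^ n) * unit_root q (h * (m + n)))%C).
    - rewrite csum_mult_l, unit_root_orthogonality_mod by exact Hq.
      destruct (Nat.eqb_spec ((m + n) mod q) 0) as [E|E]; [exfalso|ring].
      apply Nat.Div0.mod_divides in E. destruct E as [c E].
      destruct c as [|[|c]]; nia.
    - intros h _. replace (h * (m + n))%nat with (m * h + n * h)%nat by ring.
      rewrite unit_root_add. ring. }
rewrite (csum_single (fun n => csum (fun h =>
  unit_root q (m * h) * (RtoC (r ^ n) * Cconj (unit_root q (n * h)))) q)%C q m).
2: lia.
2:{ intros n Hn Hne.
    rewrite (csum_ext _ (fun h => RtoC (r ^ n) * unit_root q (h * (m + n * (q - 1))))%C).
    - rewrite csum_mult_l, unit_root_orthogonality_mod by exact Hq.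
      destruct (Nat.eqb_spec ((m + n * (q - 1)) mod q) 0) as [E|E]; [exfalso|ring].
      apply Nat.Div0.mod_divides in E. destruct E as [c E].
      assert (m + n * q = q * c + n)%nat by nia.
      destruct (Nat.le_gt_cases c n) as [Hc|Hc].
      + assert (m + (n - c) * q = n)%nat by nia. destruct (n - c)%nat; nia.
      + assert (m = (c - n) * q + n)%nat by nia. destruct (c - n)%nat eqn:Ec; nia.
    - intros h _. rewrite unit_root_conj by exact Hq.
      replace (h * (m + n * (q - 1)))%nat with (m * h + n * h * (q - 1))%nat by ring.
      rewrite unit_root_add. ring. }
rewrite (csum_ext _ (fun h => RtoC (r ^ (q - m)) * unit_root q (h * q))%C).
2:{ intros h _. replace (h * q)%nat with (m * h + (q - m) * h)%nat by nia.
    rewrite unit_root_add. ring. }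
rewrite (csum_ext (fun i => unit_root q (m * i) * (RtoC (r ^ m) * Cconj (unit_root q (m * i))))%C
            (fun h => RtoC (r ^ m) * unit_root q (h * (m * q)))%C).
2:{ intros h _. rewrite unit_root_conj by exact Hq.
    replace (h * (m * q))%nat with (m * h + m * h * (q - 1))%nat by nia.
    rewrite unit_root_add. ring. }
rewrite !csum_mult_l, !unit_root_orthogonality_mod by exact Hq.
rewrite Nat.Div0.mod_same, Nat.Div0.mod_mul. simpl Nat.eqb. cbv iota.
rewrite RtoC_mult, RtoC_plus. ring.
Qed.

(** The twisted Gauss sum writes tau(chi) conj(chi(h)) as a finite Fourier transform of chi, which
    is moved onto the kernel by exchanging the sums. Evenness makes the contributions of r^m and
    r^(q-m) equal, whence the factor 2. *)
Lemma char_poisson_sum (y : R) (q : nat) (chi : nat -> C) :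
  primitive_char q chi -> (1 < q)%nat -> even_char q chi -> 0 < y ->
  (gauss_sum q chi
     * csum (fun h => Cconj (chi h) * RtoC (poisson y (INR h / INR q))) q
     * RtoC (1 - exp (- y) ^ q)
   = RtoC (2 * INR q) * csum (fun m => chi m * RtoC (exp (- y) ^ m)) q)%C.
Proof.
intros Hprim Hq He Hy. pose proof Hprim as [Hc _].
assert (Hz : chi 0%nat = RtoC 0) by now apply (char_0 q).
rewrite <- csum_mult_l.
rewrite (csum_ext _ (fun h => csum (fun m =>
   chi m * (unit_root q (m * h) * RtoC (poisson y (INR h / INR q)))) q)%C).
2:{ intros h _.
    replace (gauss_sum q chi * (Cconj (chi h) * RtoC (poisson y (INR h / INR q))))%C
      with ((Cconj (chi h) * gauss_sum q chi) * RtoC (poisson y (INR h / INR q)))%C by ring.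
    rewrite <- gauss_sum_twist by assumption. rewrite <- csum_mult_r.
    apply csum_ext. intros; ring. }
rewrite csum_swap, <- csum_mult_r.
rewrite (csum_ext _ (fun m => RtoC (INR q) * (chi m * RtoC (exp (- y) ^ m))
    + RtoC (INR q) * (chi (q - m)%nat * RtoC (exp (- y) ^ (q - m))))%C).
(* The transform of the kernel is known only for 0 < m; at m = 0 both sides vanish because chi(0) =
   chi(q) = 0. *)
2:{ intros m Hm. rewrite csum_mult_l.
    destruct m as [|m].
    - rewrite Nat.sub_0_r. replace q with (0 + 1 * q)%nat at 5 by lia.
      rewrite char_add_mul by exact Hc. rewrite Hz. ring.
    - rewrite <- Cmult_assoc, poisson_dft by (assumption || lia).
      rewrite even_char_reflect by (assumption || lia).
      rewrite RtoC_mult, RtoC_plus. ring. }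
rewrite csum_plus, !csum_mult_l.
rewrite (csum_reflect (fun m => chi m * RtoC (exp (- y) ^ m))%C).
- rewrite RtoC_mult. ring.
- replace q with (0 + 1 * q)%nat at 1 by lia.
  rewrite char_add_mul by exact Hc. rewrite Hz. ring.
Qed.

(** * Partial fractions of the Poisson kernel *)

(** For y > 0, the Fourier transform of exp(-y|t|) at frequency v. The partial fractions below are
    thus Poisson summation for that function. *)
Definition pf (y v : R) : R := 2 * y / (y ^ 2 + (2 * PI * v) ^ 2).

(** Half of a lattice sum: since [pf] is even in its second argument, the sum over al + Z is the sum
    of the values at [b = al] and [b = 1 - al]. *)
Definition pf_sum (y b : R) : R := Series (fun j => pf y (INR j + b)).

Lemma pf_pos (y v : R) : 0 < y -> 0 < pf y v.
Proof.
intros Hy. apply Rdiv_lt_0_compat; [lra|].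
pose proof (pow2_ge_0 (2 * PI * v)). pose proof (pow_lt y 2 Hy). lra.
Qed.

Lemma is_series_telescope : is_series (fun j => / ((INR j + 1) * (INR j + 2))) 1.
Proof.
assert (E : forall n, sum_n (fun j => / ((INR j + 1) * (INR j + 2))) n = 1 - / (INR n + 2)).
{ induction n as [|n IH].
  - rewrite sum_O. simpl. field.
  - rewrite sum_Sn, IH, S_INR. pose proof (pos_INR n). unfold plus; simpl. field. lra. }
apply (is_lim_seq_ext (fun n => 1 - / (INR n + 2)) _ 1); [intros; symmetry; apply E|].
replace (Finite 1) with (Finite (1 - 0)) by (f_equal; ring).
apply is_lim_seq_minus'; [apply is_lim_seq_const|].
apply (is_lim_seq_inv _ p_infty); [|discriminate].
apply (is_lim_seq_plus _ _ p_infty 2); [apply is_lim_seq_INR|apply is_lim_seq_const|reflexivity].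
Qed.

Lemma pf_tail_le (y b : R) (j : nat) :
  0 < y -> 0 <= b -> pf y (INR (S j) + b) <= y * / ((INR j + 1) * (INR j + 2)).
Proof.
intros Hy Hb. rewrite S_INR. pose proof (pos_INR j) as Hj. set (t := INR j) in *.
pose proof PI2_1. pose proof (pow_lt y 2 Hy).
unfold pf, Rdiv. rewrite (Rmult_comm 2 y), Rmult_assoc.
apply Rmult_le_compat_l; [lra|].
assert (H1 : 2 * ((t + 1) * (t + 2)) <= y ^ 2 + (2 * PI * (t + 1 + b)) ^ 2).
{ assert (2 * (t + 1) <= 2 * PI * (t + 1 + b)) by nra.
  assert ((2 * (t + 1)) ^ 2 <= (2 * PI * (t + 1 + b)) ^ 2) by (apply pow_incr; nra).
  nra. }
assert (0 < (t + 1) * (t + 2)) by nra.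
replace (2 * / (y ^ 2 + (2 * PI * (t + 1 + b)) ^ 2))
  with (/ ((y ^ 2 + (2 * PI * (t + 1 + b)) ^ 2) / 2)) by (field; lra).
apply Rinv_le_contravar; lra.
Qed.

Lemma ex_series_pf_tail (y b : R) :
  0 < y -> 0 <= b -> ex_series (fun j => pf y (INR (S j) + b)).
Proof.
intros Hy Hb.
apply (ex_series_le (V := R_CompleteNormedModule) _ (fun j => y * / ((INR j + 1) * (INR j + 2)))).
- intros j. unfold norm; simpl. unfold abs; simpl.
  rewrite Rabs_pos_eq by (left; now apply pf_pos). now apply pf_tail_le.
- apply (ex_series_scal (K := R_AbsRing) (V := R_NormedModule) y). exists 1. apply is_series_telescope.
Qed.

Lemma ex_series_pf (y b : R) : 0 < y -> 0 <= b -> ex_series (fun j => pf y (INR j + b)).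
Proof. intros Hy Hb. apply ex_series_incr_1. now apply ex_series_pf_tail. Qed.

(** Only the term j = 0 can be large for small y. The others are dominated by [y] times a
    telescoping series of sum 1. *)
Lemma pf_sum_bounds (y b : R) :
  0 < y -> 0 <= b -> pf y b <= pf_sum y b <= pf y b + y.
Proof.
intros Hy Hb. unfold pf_sum. rewrite Series_incr_1 by now apply ex_series_pf.
replace (INR 0 + b) with b by (simpl; ring).
assert (0 <= Series (fun j => pf y (INR (S j) + b))).
{ rewrite <- (Rmult_0_l (Series (fun j => pf y (INR (S j) + b)))), <- Series_scal_l.
  apply Series_le.
  - intros n. pose proof (pf_pos y (INR (S n) + b) Hy). lra.
  - now apply ex_series_pf_tail. }
assert (Series (fun j => pf y (INR (S j) + b)) <= y).
{ apply Rle_trans with (Series (fun j => y * / ((INR j + 1) * (INR j + 2)))).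
  2:{ rewrite Series_scal_l, (is_series_unique _ _ is_series_telescope). lra. }
  apply Series_le.
  - intros n; split; [left; now apply pf_pos|now apply pf_tail_le].
  - apply (ex_series_scal (K := R_AbsRing) (V := R_NormedModule) y). exists 1. apply is_series_telescope. }
lra.
Qed.

Lemma Series_even_odd (f : nat -> R) :
  ex_series f -> ex_series (fun j => f (2 * j)%nat) -> ex_series (fun j => f (2 * j + 1)%nat) ->
  Series (fun j => f (2 * j)%nat) + Series (fun j => f (2 * j + 1)%nat) = Series f.
Proof.
intros Hf H0 H1. rewrite <- Series_plus by assumption.
apply is_series_unique.
assert (E : forall n, sum_n (fun j => f (2 * j)%nat + f (2 * j + 1)%nat) n
                     = sum_n f (2 * n + 1)).
{ induction n as [|n IH].
  - simpl. rewrite sum_Sn, !sum_O. reflexivity.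
  - rewrite sum_Sn, IH. replace (2 * S n + 1)%nat with (S (S (2 * n + 1))) by lia.
    rewrite !sum_Sn.
    change (sum_n f (2 * n + 1) + (f (2 * S n)%nat + f (S (S (2 * n + 1))))
            = sum_n f (2 * n + 1) + f (S (2 * n + 1)) + f (S (S (2 * n + 1)))).
    replace (2 * S n)%nat with (S (2 * n + 1)) by lia.
    ring. }
apply (is_lim_seq_ext (fun n => sum_n f (2 * n + 1)) _ (Series f)); [intros; symmetry; apply E|].
apply (is_lim_seq_subseq (sum_n f) _ (fun n => (2 * n + 1)%nat)).
- apply eventually_subseq. intros; lia.
- exact (Series_correct f Hf).
Qed.

Lemma pf_double (y v : R) : 0 < y -> pf y (v / 2) = 2 * pf (2 * y) v.
Proof.
intros Hy. unfold pf. pose proof (pow2_ge_0 (2 * PI * v)). pose proof (pow_lt y 2 Hy).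
field. repeat split; nra.
Qed.

(** By homogeneity ([pf_double]), the points j + b/2 and j + (b + 1)/2 give the even and the odd
    terms of a single series at scale [2 * y]. *)
Lemma pf_sum_double (y b : R) :
  0 < y -> 0 <= b -> pf_sum y (b / 2) + pf_sum y ((b + 1) / 2) = 2 * pf_sum (2 * y) b.
Proof.
intros Hy Hb. unfold pf_sum. rewrite <- Series_scal_l.
rewrite <- (Series_even_odd (fun i => 2 * pf (2 * y) (INR i + b))).
- f_equal; apply Series_ext; intros j; rewrite <- pf_double by exact Hy; f_equal.
  + rewrite mult_INR. simpl. field.
  + rewrite plus_INR, mult_INR. simpl. field.
- apply (ex_series_scal (K := R_AbsRing) (V := R_NormedModule) 2). apply ex_series_pf; lra.
- apply (ex_series_ext (fun j => pf y (INR j + b / 2))).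
  + intros j. rewrite <- pf_double by exact Hy; f_equal. rewrite mult_INR; simpl; field.
  + apply ex_series_pf; lra.
- apply (ex_series_ext (fun j => pf y (INR j + (b + 1) / 2))).
  + intros j. rewrite <- pf_double by exact Hy; f_equal. rewrite plus_INR, mult_INR; simpl; field.
  + apply ex_series_pf; lra.
Qed.

Lemma sinh_pos (y : R) : 0 < y -> 0 < sinh y.
Proof.
intros Hy. unfold sinh. assert (exp (- y) < exp y) by (apply exp_increasing; lra). lra.
Qed.

Lemma cosh_sq (y : R) : cosh y ^ 2 = 1 + sinh y ^ 2.
Proof. unfold cosh, sinh. rewrite exp_Ropp. field. apply Rgt_not_eq, exp_pos. Qed.

Lemma sinh_double (y : R) : sinh (2 * y) = 2 * sinh y * cosh y.
Proof.
unfold cosh, sinh. replace (2 * y) with (y + y) by ring. rewrite !exp_Ropp, exp_plus.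
field. apply Rgt_not_eq, exp_pos.
Qed.

Lemma cosh_double (y : R) : cosh (2 * y) = 2 * cosh y ^ 2 - 1.
Proof.
unfold cosh, sinh. replace (2 * y) with (y + y) by ring. rewrite !exp_Ropp, exp_plus.
field. apply Rgt_not_eq, exp_pos.
Qed.

(** In the Fourier series, averaging over the two half angles keeps the even modes, and mode 2n at
    [y] is mode n at [2 * y]. In closed form, the half turn changes the sign of the cosine and the
    denominators multiply to a difference of squares. *)
Lemma poisson_double (y al : R) :
  0 < y -> poisson y (al / 2) + poisson y ((al + 1) / 2) = 2 * poisson (2 * y) al.
Proof.
intros Hy. unfold poisson.
replace (2 * PI * (al / 2)) with (PI * al) by field.
replace (2 * PI * ((al + 1) / 2)) with (PI * al + PI) by field.
replace (2 * PI * al) with (2 * (PI * al)) by ring.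
rewrite neg_cos, sinh_double, cosh_double, cos_2a_cos.
pose proof (cosh_gt_1 y Hy). pose proof (COS_bound (PI * al)).
field. repeat split; nra.
Qed.

(** Engine of the Taylor bounds that follow, most of which integrate an earlier one. *)
Lemma nonneg_of_derive_nonneg (f df : R -> R) (b : R) :
  f 0 = 0 -> (forall x, 0 <= x <= b -> is_derive f x (df x)) ->
  (forall x, 0 <= x <= b -> 0 <= df x) -> forall x, 0 <= x <= b -> 0 <= f x.
Proof.
intros H0 Hd Hp x Hx.
destruct (MVT_gen f 0 x df) as [c [Hc E]].
- intros t Ht. rewrite Rmin_left, Rmax_right in Ht by lra. apply Hd; lra.
- intros t Ht. rewrite Rmin_left, Rmax_right in Ht by lra.
  apply derivable_continuous_pt. exists (df t). apply is_derive_Reals, Hd; lra.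
- rewrite Rmin_left, Rmax_right in Hc by lra. pose proof (Hp c ltac:(lra)). nra.
Qed.

Lemma is_derive_sinh (x : R) : is_derive sinh x (cosh x).
Proof. apply is_derive_Reals, derivable_pt_lim_sinh. Qed.

Lemma is_derive_cosh (x : R) : is_derive cosh x (sinh x).
Proof. apply is_derive_Reals, derivable_pt_lim_cosh. Qed.

Lemma cosh_ge_1 (y : R) : 1 <= cosh y.
Proof.
pose proof (cosh_sq y). pose proof (pow2_ge_0 (sinh y)).
assert (0 < cosh y) by (unfold cosh; pose proof (exp_pos y); pose proof (exp_pos (- y)); lra).
nra.
Qed.

Lemma sinh_ge_id (y : R) : 0 <= y <= 1 -> y <= sinh y.
Proof.
intros Hy. enough (0 <= sinh y - y) by lra.
apply (nonneg_of_derive_nonneg (fun x => sinh x - x) (fun x => cosh x - 1) 1); try assumption.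
- rewrite sinh_0. ring.
- intros x _. apply (is_derive_minus sinh (fun x => x)); [apply is_derive_sinh|apply @is_derive_id].
- intros x _. pose proof (cosh_ge_1 x). lra.
Qed.

Lemma cosh_le_2 (y : R) : 0 <= y <= 1 -> cosh y <= 2.
Proof.
intros Hy. unfold cosh.
assert (exp y <= 3).
{ apply Rle_trans with (exp 1); [|apply exp_le_3].
  destruct (Req_dec y 1) as [->|]; [lra|left; apply exp_increasing; lra]. }
assert (exp (- y) <= 1).
{ rewrite <- exp_0. destruct (Req_dec y 0) as [->|]; [rewrite Ropp_0; lra|left; apply exp_increasing; lra]. }
lra.
Qed.

Lemma sinh_le_double (y : R) : 0 <= y <= 1 -> sinh y <= 2 * y.
Proof.
intros Hy. enough (0 <= 2 * y - sinh y) by lra.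
apply (nonneg_of_derive_nonneg (fun x => 2 * x - sinh x) (fun x => 2 - cosh x) 1); try assumption.
- rewrite sinh_0. ring.
- intros x _. apply (is_derive_minus (fun x => 2 * x) sinh); [|apply is_derive_sinh].
  auto_derive; trivial; ring.
- intros x Hx. pose proof (cosh_le_2 x Hx). lra.
Qed.

Lemma cosh_le (y : R) : 0 <= y <= 1 -> cosh y <= 1 + y ^ 2.
Proof.
intros Hy. enough (0 <= 1 + y ^ 2 - cosh y) by lra.
apply (nonneg_of_derive_nonneg (fun x => 1 + x ^ 2 - cosh x) (fun x => 2 * x - sinh x) 1);
  try assumption.
- rewrite cosh_0. ring.
- intros x _. apply (is_derive_minus (fun x => 1 + x ^ 2) cosh); [|apply is_derive_cosh].
  auto_derive; trivial; ring.
- intros x Hx. pose proof (sinh_le_double x Hx). lra.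
Qed.

Lemma sinh_le (y : R) : 0 <= y <= 1 -> sinh y <= y + y ^ 3.
Proof.
intros Hy. enough (0 <= y + y ^ 3 - sinh y) by lra.
apply (nonneg_of_derive_nonneg (fun x => x + x ^ 3 - sinh x) (fun x => 1 + 3 * x ^ 2 - cosh x) 1);
  try assumption.
- rewrite sinh_0. ring.
- intros x _. apply (is_derive_minus (fun x => x + x ^ 3) sinh); [|apply is_derive_sinh].
  auto_derive; trivial; ring.
- intros x Hx. pose proof (cosh_le x Hx). pose proof (pow2_ge_0 x). lra.
Qed.

Lemma sin_le_id (x : R) : 0 <= x <= 2 -> sin x <= x.
Proof.
intros Hx. enough (0 <= x - sin x) by lra.
apply (nonneg_of_derive_nonneg (fun x => x - sin x) (fun x => 1 - cos x) 2); try assumption.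
- rewrite sin_0. ring.
- intros t _. auto_derive; trivial; ring.
- intros t _. pose proof (COS_bound t). lra.
Qed.

Lemma cos_ge_quadratic (x : R) : 0 <= x <= 2 -> 1 - x ^ 2 / 2 <= cos x.
Proof.
intros Hx. enough (0 <= cos x - 1 + x ^ 2 / 2) by lra.
apply (nonneg_of_derive_nonneg (fun x => cos x - 1 + x ^ 2 / 2) (fun x => x - sin x) 2);
  try assumption.
- rewrite cos_0. field.
- intros t _. auto_derive; trivial; field.
- intros t Ht. pose proof (sin_le_id t Ht). lra.
Qed.

Lemma sin_ge_cubic (x : R) : 0 <= x <= 2 -> x - x ^ 3 / 6 <= sin x.
Proof.
intros Hx. enough (0 <= sin x - x + x ^ 3 / 6) by lra.
apply (nonneg_of_derive_nonneg (fun x => sin x - x + x ^ 3 / 6) (fun x => cos x - 1 + x ^ 2 / 2) 2);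
  try assumption.
- rewrite sin_0. field.
- intros t _. auto_derive; trivial; field.
- intros t Ht. pose proof (cos_ge_quadratic t Ht). lra.
Qed.

(* With Y = y/2 and phi = pi al the two sides are
   sinh Y cosh Y / (sinh^2 Y + sin^2 phi) and Y / (Y^2 + phi^2). *)
Lemma poisson_near_pf (y al : R) :
  0 < y <= 1 -> 0 <= al <= 1 / 2 -> Rabs (poisson y al - pf y al) <= 18 * y.
Proof.
intros Hy Hal. set (Y := y / 2). set (phi := PI * al).
assert (Hphi : 0 <= phi <= 2).
{ unfold phi. pose proof PI_4. pose proof PI_RGT_0. split; nra. }
assert (E1 : poisson y al = sinh Y * cosh Y / (sinh Y ^ 2 + sin phi ^ 2)).
{ unfold poisson. replace y with (2 * Y) by (unfold Y; field).
  replace (2 * PI * al) with (2 * phi) by (unfold phi; ring).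
  rewrite sinh_double, cosh_double, cos_2a_sin, cosh_sq.
  assert (0 < sinh Y) by (apply sinh_pos; unfold Y; lra).
  pose proof (pow2_ge_0 (sin phi)). field. repeat split; nra. }
assert (E2 : pf y al = Y / (Y ^ 2 + phi ^ 2)).
{ unfold pf, Y, phi. pose proof (pow2_ge_0 (PI * al)). field. repeat split; nra. }
rewrite E1, E2.
assert (HY : 0 < Y <= 1 / 2) by (unfold Y; lra).
pose proof (sinh_ge_id Y ltac:(lra)) as B1. pose proof (sinh_le Y ltac:(lra)) as B2.
pose proof (cosh_ge_1 Y) as B3. pose proof (cosh_le Y ltac:(lra)) as B4.
pose proof (sin_le_id phi Hphi) as B5. pose proof (sin_ge_cubic phi Hphi) as B6.
set (Sh := sinh Y) in *. set (Ch := cosh Y) in *. set (s := sin phi) in *.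
replace (18 * y) with (36 * Y) by (unfold Y; field).
clearbody Sh Ch s. clear E1 E2. clearbody Y phi.
(* With phi <= 2, phi - phi^3/6 >= phi/3. So the true denominator is at least Q/9, and a numerator
   of size 4 Y Q^2 gives the bound 36 Y = 18 y. *)
assert (Hs : phi / 3 <= s) by nra.
assert (HQ : 0 < Y ^ 2 + phi ^ 2) by nra.
assert (HD : (Y ^ 2 + phi ^ 2) / 9 <= Sh ^ 2 + s ^ 2) by nra.
assert (HD0 : 0 < Sh ^ 2 + s ^ 2) by nra.
set (Q := Y ^ 2 + phi ^ 2) in *.
assert (E : Sh * Ch / (Sh ^ 2 + s ^ 2) - Y / Q
            = (Sh * Ch * Q - Y * (Sh ^ 2 + s ^ 2)) / ((Sh ^ 2 + s ^ 2) * Q)) by (field; lra).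
assert (HU : Sh * Ch * Q - Y * (Sh ^ 2 + s ^ 2) <= 4 * Y * Q ^ 2).
{ assert (U1 : Sh * Ch <= Y * (1 + 3 * Y ^ 2)).
  { apply Rle_trans with ((Y + Y ^ 3) * (1 + Y ^ 2)).
    - apply Rmult_le_compat; lra.
    - assert (Y ^ 2 <= 1) by nra. assert (0 <= Y * Y ^ 2) by nra. nra. }
  assert (U2 : phi ^ 2 - s ^ 2 <= phi ^ 4 / 3).
  { assert (0 <= phi ^ 3) by (apply pow_le; lra).
    assert ((phi - s) * (phi + s) <= phi ^ 3 / 6 * (2 * phi)) by (apply Rmult_le_compat; lra).
    nra. }
  assert (U3 : Sh * Ch * Q <= Y * (1 + 3 * Y ^ 2) * Q) by (apply Rmult_le_compat_r; lra).
  assert (U4 : Y ^ 2 + s ^ 2 >= Q - phi ^ 4 / 3) by (unfold Q; lra).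
  assert (U5 : Y ^ 2 <= Sh ^ 2) by (apply pow_incr; lra).
  assert (U6 : Y * (Q - phi ^ 4 / 3) <= Y * (Sh ^ 2 + s ^ 2)) by (apply Rmult_le_compat_l; lra).
  assert (U7 : phi ^ 4 <= Q ^ 2) by (unfold Q; nra).
  assert (U8 : Y ^ 2 * Q <= Q ^ 2) by (unfold Q; nra).
  nra. }
assert (HL : - (4 * Y * Q ^ 2) <= Sh * Ch * Q - Y * (Sh ^ 2 + s ^ 2)).
{ assert (L1 : Y * Q <= Sh * Ch * Q) by (apply Rmult_le_compat_r; nra).
  assert (L2 : Sh ^ 2 <= (Y + Y ^ 3) ^ 2) by (apply pow_incr; lra).
  assert (L3 : s ^ 2 <= phi ^ 2) by (apply pow_incr; lra).
  assert (L4 : (Y + Y ^ 3) ^ 2 <= Y ^ 2 + 3 * Y ^ 4).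
  { assert (Y ^ 6 <= Y ^ 4); [|lra].
    replace (Y ^ 6) with (Y ^ 4 * Y ^ 2) by ring.
    assert (0 <= Y ^ 4) by (apply pow_le; lra). assert (Y ^ 2 <= 1) by nra. nra. }
  assert (L5 : Y ^ 4 <= Q ^ 2) by (unfold Q; nra).
  assert (L6 : Sh ^ 2 + s ^ 2 <= Q + 3 * Q ^ 2) by (unfold Q in *; lra).
  assert (Y * (Sh ^ 2 + s ^ 2) <= Y * (Q + 3 * Q ^ 2)) by (apply Rmult_le_compat_l; lra).
  assert (0 <= Y * Q ^ 2) by (apply Rmult_le_pos; [lra|apply pow2_ge_0]). nra. }
rewrite E. unfold Rdiv. rewrite Rabs_mult, Rabs_inv, (Rabs_pos_eq ((Sh ^ 2 + s ^ 2) * Q)) by nra.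
apply Rmult_le_reg_r with ((Sh ^ 2 + s ^ 2) * Q); [nra|].
rewrite Rmult_assoc, Rinv_l by nra. rewrite Rmult_1_r.
apply Rle_trans with (4 * Y * Q ^ 2).
- apply Rabs_le. lra.
- assert (36 * Y * (Q / 9 * Q) <= 36 * Y * ((Sh ^ 2 + s ^ 2) * Q)).
  { apply Rmult_le_compat_l; [lra|]. apply Rmult_le_compat_r; lra. }
  nra.
Qed.

Definition poisson_defect (y al : R) : R :=
  poisson y al - pf_sum y al - pf_sum y (1 - al).

Lemma poisson_reflect (y al : R) : poisson y (1 - al) = poisson y al.
Proof.
unfold poisson.
replace (2 * PI * (1 - al)) with (- (2 * PI * al) + 2 * INR 1 * PI) by (simpl; ring).
now rewrite cos_period, cos_neg.
Qed.

Lemma pf_half_le (y b : R) : 0 < y -> 1 / 2 <= b -> pf y b <= y.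
Proof.
intros Hy Hb. unfold pf. apply Rmult_le_reg_r with (y ^ 2 + (2 * PI * b) ^ 2).
- pose proof (pow2_ge_0 (2 * PI * b)). pose proof (pow_lt y 2 Hy). lra.
- pose proof (pow2_ge_0 (2 * PI * b)). pose proof (pow_lt y 2 Hy).
  unfold Rdiv. rewrite Rmult_assoc, Rinv_l by lra. rewrite Rmult_1_r.
  assert (3 <= 2 * PI * b) by (pose proof PI2_3_2; nra).
  assert (2 <= (2 * PI * b) ^ 2) by nra. nra.
Qed.

(** 21 = 18 + 1 + 2: the distance from the kernel to its main fraction, the tail of the first half
    lattice, and the whole second half lattice, which stays at distance at least 1/2 from 0 once al
    <= 1/2. The symmetry al -> 1 - al covers the rest. *)
Lemma poisson_defect_small (y al : R) :
  0 < y <= 1 -> 0 <= al <= 1 -> Rabs (poisson_defect y al) <= 21 * y.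
Proof.
assert (H : forall al, 0 < y <= 1 -> 0 <= al <= 1 / 2 -> Rabs (poisson_defect y al) <= 21 * y).
{ clear al. intros al Hy Hal. unfold poisson_defect.
  pose proof (poisson_near_pf y al Hy Hal) as H1. apply Rabs_le_between in H1.
  pose proof (pf_sum_bounds y al ltac:(lra) ltac:(lra)).
  pose proof (pf_sum_bounds y (1 - al) ltac:(lra) ltac:(lra)).
  pose proof (pf_half_le y (1 - al) ltac:(lra) ltac:(lra)).
  pose proof (pf_pos y (1 - al) ltac:(lra)).
  apply Rabs_le. lra. }
intros Hy Hal. destruct (Rle_dec al (1 / 2)) as [L|L]; [apply H; lra|].
replace (poisson_defect y al) with (poisson_defect y (1 - al)); [apply H; lra|].
unfold poisson_defect. rewrite poisson_reflect.
replace (1 - (1 - al)) with al by ring. ring.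
Qed.

Lemma poisson_defect_double (y al : R) :
  0 < y -> 0 <= al <= 1 ->
  poisson_defect y (al / 2) + poisson_defect y ((al + 1) / 2) = 2 * poisson_defect (2 * y) al.
Proof.
intros Hy Hal. unfold poisson_defect.
pose proof (poisson_double y al Hy). pose proof (pf_sum_double y al Hy ltac:(lra)).
pose proof (pf_sum_double y (1 - al) Hy ltac:(lra)) as E.
replace ((1 - al) / 2) with (1 - (al + 1) / 2) in E by field.
replace ((1 - al + 1) / 2) with (1 - al / 2) in E by field. lra.
Qed.

(* The doubling formula lets a bound on the defect at y / 2^k propagate to y. *)
Lemma poisson_partial_fractions (y al : R) :
  0 < y -> 0 <= al <= 1 -> poisson y al = pf_sum y al + pf_sum y (1 - al).
Proof.
intros Hy Hal.
(* The bound [B] has to be uniform in [al]: the defect at [2 * y] is the mean of the defects at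
   [al / 2] and [(al + 1) / 2], both again in [0, 1]. *)
assert (Hk : forall k B y, 0 < y ->
   (forall al, 0 <= al <= 1 -> Rabs (poisson_defect y al) <= B) ->
   forall al, 0 <= al <= 1 -> Rabs (poisson_defect (2 ^ k * y) al) <= B).
{ clear. induction k as [|k IH]; intros B y Hy HB al Hal.
  - simpl. rewrite Rmult_1_l. now apply HB.
  - replace (2 ^ S k * y) with (2 ^ k * (2 * y)) by (simpl; ring).
    apply IH; [lra| |exact Hal]. clear al Hal. intros al Hal.
    pose proof (poisson_defect_double y al Hy Hal) as E.
    pose proof (HB (al / 2) ltac:(lra)) as H1. pose proof (HB ((al + 1) / 2) ltac:(lra)) as H2.
    apply Rabs_le_between in H1. apply Rabs_le_between in H2. apply Rabs_le. lra. }
assert (H0 : Rabs (poisson_defect y al) <= 0).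
{ apply (is_lim_seq_le_loc (fun _ => Rabs (poisson_defect y al)) (fun k => 21 * y * (/ 2) ^ k)
           (Rabs (poisson_defect y al)) 0).
  - destruct (Pow_x_infinity 2 ltac:(rewrite Rabs_pos_eq; lra) y) as [N HN].
    exists N. intros k HNk. specialize (HN k HNk).
    assert (H2 : 0 < 2 ^ k) by (apply pow_lt; lra).
    rewrite Rabs_pos_eq in HN by lra.
    replace y with (2 ^ k * (y * (/ 2) ^ k)) at 1.
    2:{ rewrite pow_inv. field. lra. }
    apply Hk; [apply Rmult_lt_0_compat; [lra|apply pow_lt; lra] | | exact Hal].
    intros b Hb. rewrite Rmult_assoc. apply poisson_defect_small; [|exact Hb].
    split; [apply Rmult_lt_0_compat; [lra|apply pow_lt; lra]|].
    rewrite pow_inv. apply Rmult_le_reg_r with (2 ^ k); [lra|].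
    rewrite Rmult_assoc, Rinv_l by lra. lra.
  - apply is_lim_seq_const.
  - replace (Finite 0) with (Rbar_mult (21 * y) 0) by (simpl; f_equal; ring).
    apply is_lim_seq_scal_l. apply is_lim_seq_geom. rewrite Rabs_pos_eq; lra. }
assert (poisson_defect y al = 0).
{ destruct (Req_dec (poisson_defect y al) 0) as [E|E]; [exact E|].
  apply Rabs_pos_lt in E. lra. }
unfold poisson_defect in H. lra.
Qed.

(** * Integrals over the real line *)

(** An improper integral along integer windows. Continuity is built in so that every window is
    integrable and linearity needs no side conditions. *)
Definition line_integral (f : R -> R) (v : R) : Prop :=
  (forall x, continuous f x) /\
  is_lim_seq (fun n => RInt f (- INR n) (INR n)) v.

Lemma continuous_ex_RInt (f : R -> R) (a b : R) :
  (forall x, continuous f x) -> ex_RInt f a b.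
Proof. intros H. apply (ex_RInt_continuous (V := R_CompleteNormedModule)). intros; apply H. Qed.

Lemma line_integral_ext (f g : R -> R) (v : R) :
  (forall x, f x = g x) -> line_integral f v -> line_integral g v.
Proof.
intros E [Hc Hl]. split.
- intros x. now apply (continuous_ext f).
- apply (is_lim_seq_ext (fun n => RInt f (- INR n) (INR n))); [|exact Hl].
  intros n. apply RInt_ext. intros; apply E.
Qed.

Lemma line_integral_0 : line_integral (fun _ => 0) 0.
Proof.
split; [intros; apply continuous_const|].
apply (is_lim_seq_ext (fun _ => 0)); [|apply is_lim_seq_const].
intros n. rewrite RInt_const. unfold scal; simpl. unfold mult; simpl. ring.
Qed.

Lemma line_integral_plus (f g : R -> R) (u v : R) :
  line_integral f u -> line_integral g v -> line_integral (fun x => f x + g x) (u + v).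
Proof.
intros [Hf Lf] [Hg Lg]. split.
- intros x. apply (continuous_plus f g); [apply Hf|apply Hg].
- apply (is_lim_seq_ext (fun n => RInt f (- INR n) (INR n) + RInt g (- INR n) (INR n))).
  + intros n. symmetry. apply (RInt_plus f g); now apply continuous_ex_RInt.
  + now apply is_lim_seq_plus'.
Qed.

Lemma line_integral_scal (k : R) (f : R -> R) (v : R) :
  line_integral f v -> line_integral (fun x => k * f x) (k * v).
Proof.
intros [Hf Lf]. split.
- intros x. apply (continuous_scal_r k f). apply Hf.
- apply (is_lim_seq_ext (fun n => k * RInt f (- INR n) (INR n))).
  + intros n. symmetry. apply (RInt_scal f); now apply continuous_ex_RInt.
  + apply (is_lim_seq_scal_l _ k v Lf).
Qed.

(** Equal to 1 / (2 cosh(u/2)): it decays like exp(-|u|/2) and has the elementary primitive 2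
    atan(exp(u/2)). *)
Definition sech_weight (u : R) : R := / (exp (u / 2) + exp (- (u / 2))).

Lemma sech_weight_pos (u : R) : 0 < sech_weight u.
Proof.
apply Rinv_0_lt_compat. pose proof (exp_pos (u / 2)). pose proof (exp_pos (- (u / 2))). lra.
Qed.

Lemma continuous_sech_weight (x : R) : continuous sech_weight x.
Proof.
apply (ex_derive_continuous (V := R_NormedModule)). unfold sech_weight. auto_derive.
pose proof (exp_pos (x * / 2)). pose proof (exp_pos (- (x * / 2))). lra.
Qed.

Lemma is_derive_atan_exp (x : R) :
  is_derive (fun u => 2 * atan (exp (u / 2))) x (sech_weight x).
Proof.
unfold sech_weight. pose proof (exp_pos (x / 2)) as H.
auto_derive; [trivial|].
fold (x / 2). rewrite exp_Ropp.
unfold Rsqr. field. repeat split; nra.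
Qed.

(** The crude constant comes from |atan| < PI/2, which gives 2 PI, and from PI <= 4. *)
Lemma RInt_sech_weight_le (n : nat) : RInt sech_weight (- INR n) (INR n) <= 8.
Proof.
assert (E : RInt sech_weight (- INR n) (INR n)
  = 2 * atan (exp (INR n / 2)) - 2 * atan (exp (- INR n / 2))).
{ apply is_RInt_unique.
  apply (is_RInt_derive (V := R_CompleteNormedModule) (fun u => 2 * atan (exp (u / 2)))).
  - intros; apply is_derive_atan_exp.
  - intros; apply continuous_sech_weight. }
rewrite E. pose proof (atan_bound (exp (INR n / 2))). pose proof (atan_bound (exp (- INR n / 2))).
pose proof PI_4. lra.
Qed.

Lemma line_integral_abs_le (f : R -> R) (v B : R) :
  0 <= B -> line_integral f v -> (forall u, Rabs (f u) <= B * sech_weight u) -> Rabs v <= 8 * B.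
Proof.
intros HB [Hf Lf] H.
apply (is_lim_seq_le (fun n => Rabs (RInt f (- INR n) (INR n))) (fun _ => 8 * B) (Rabs v) (8 * B)).
- intros n. pose proof (pos_INR n).
  apply Rle_trans with (B * RInt sech_weight (- INR n) (INR n)).
  + apply (norm_RInt_le (V := R_NormedModule) f (fun u => B * sech_weight u) (- INR n) (INR n)).
    * lra.
    * intros x _. apply H.
    * apply (RInt_correct (V := R_CompleteNormedModule)). now apply continuous_ex_RInt.
    * apply (is_RInt_scal sech_weight).
      apply (RInt_correct (V := R_CompleteNormedModule)).
      apply continuous_ex_RInt, continuous_sech_weight.
  + rewrite (Rmult_comm 8). apply Rmult_le_compat_l; [exact HB|apply RInt_sech_weight_le].
- apply (is_lim_seq_abs _ v Lf).
- apply is_lim_seq_const.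
Qed.

Definition line_integral_C (F : R -> C) (V : C) : Prop :=
  line_integral (fun u => Re (F u)) (Re V) /\ line_integral (fun u => Im (F u)) (Im V).

Lemma line_integral_C_ext (F G : R -> C) (V : C) :
  (forall u, F u = G u) -> line_integral_C F V -> line_integral_C G V.
Proof.
intros E [H1 H2]. split; eapply line_integral_ext; try eassumption; intros; simpl; now rewrite E.
Qed.

Lemma line_integral_C_0 : line_integral_C (fun _ => RtoC 0) (RtoC 0).
Proof. split; apply line_integral_0. Qed.

Lemma line_integral_C_plus (F G : R -> C) (U V : C) :
  line_integral_C F U -> line_integral_C G V ->
  line_integral_C (fun u => F u + G u)%C (U + V)%C.
Proof. intros [F1 F2] [G1 G2]. split; now apply line_integral_plus. Qed.

Lemma line_integral_C_scal (a : C) (f : R -> R) (v : R) :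
  line_integral f v -> line_integral_C (fun u => a * RtoC (f u))%C (a * RtoC v)%C.
Proof.
intros H. split.
- rewrite re_scal_r. apply (line_integral_ext (fun u => Re a * f u)).
  + intros; now rewrite re_scal_r.
  + now apply line_integral_scal.
- replace (Im (a * RtoC v)%C) with (Im a * v) by (unfold Im; simpl; ring).
  apply (line_integral_ext (fun u => Im a * f u)).
  + intros; unfold Im; simpl; ring.
  + now apply line_integral_scal.
Qed.

Lemma line_integral_C_mult (a : C) (F : R -> C) (V : C) :
  line_integral_C F V -> line_integral_C (fun u => a * F u)%C (a * V)%C.
Proof.
intros [H1 H2]. destruct a as [a1 a2]. destruct V as [v1 v2]. simpl in *.
pose proof (line_integral_plus _ _ _ _ (line_integral_scal a1 _ _ H1)
              (line_integral_scal (- a2) _ _ H2)) as K1.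
pose proof (line_integral_plus _ _ _ _ (line_integral_scal a1 _ _ H2)
              (line_integral_scal a2 _ _ H1)) as K2.
split.
- replace (Re ((a1, a2) * (v1, v2))%C) with (a1 * v1 + - a2 * v2) by (simpl; ring).
  eapply line_integral_ext; [|exact K1]. intros; simpl. unfold Re, Im. ring.
- replace (Im ((a1, a2) * (v1, v2))%C) with (a1 * v2 + a2 * v1) by (simpl; ring).
  eapply line_integral_ext; [|exact K2]. intros; simpl. unfold Re, Im. ring.
Qed.

Lemma line_integral_C_minus (F G : R -> C) (U V : C) :
  line_integral_C F U -> line_integral_C G V ->
  line_integral_C (fun u => F u - G u)%C (U - V)%C.
Proof.
intros HF HG. replace (U - V)%C with (U + (- (1)) * V)%C by ring.
apply (line_integral_C_ext (fun u => F u + (- (1)) * G u)%C); [intros; ring|].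
apply line_integral_C_plus; [exact HF|now apply line_integral_C_mult].
Qed.

Lemma line_integral_C_csum (F : nat -> R -> C) (V : nat -> C) (n : nat) :
  (forall i, (i < n)%nat -> line_integral_C (F i) (V i)) ->
  line_integral_C (fun u => csum (fun i => F i u) n) (csum V n).
Proof.
induction n as [|n IH]; intros H; simpl; [apply line_integral_C_0|].
apply line_integral_C_plus; [apply IH; intros; apply H; lia|apply H; lia].
Qed.

Lemma Cmod_le_Re_Im (z : C) : Cmod z <= Rabs (Re z) + Rabs (Im z).
Proof.
replace z with (RtoC (Re z) + Ci * RtoC (Im z))%C at 1.
- eapply Rle_trans; [apply Cmod_triangle|].
  rewrite Cmod_mult, Cmod_Ci, !Cmod_R. lra.
- destruct z as [a b]. unfold RtoC, Ci, Cplus, Cmult; simpl. f_equal; ring.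
Qed.

Lemma im_le_Cmod (z : C) : Rabs (Im z) <= Cmod z.
Proof. eapply Rle_trans; [apply Rmax_r|apply Rmax_Cmod]. Qed.

Lemma line_integral_C_le (F : R -> C) (V : C) (B : R) :
  0 <= B -> line_integral_C F V -> (forall u, Cmod (F u) <= B * sech_weight u) ->
  Cmod V <= 16 * B.
Proof.
intros HB [H1 H2] H. eapply Rle_trans; [apply Cmod_le_Re_Im|].
pose proof (line_integral_abs_le _ _ B HB H1
  (fun u => Rle_trans _ _ _ (re_le_Cmod (F u)) (H u))).
pose proof (line_integral_abs_le _ _ B HB H2
  (fun u => Rle_trans _ _ _ (im_le_Cmod (F u)) (H u))).
lra.
Qed.

(** * The Bessel integral *)

Lemma continuous_exp_cosh (z x : R) : continuous (fun t => exp (- z * cosh t)) x.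
Proof.
apply (ex_derive_continuous (V := R_NormedModule)). unfold cosh. now auto_derive.
Qed.

Lemma exp_cosh_le (z t : R) : 0 < z -> 0 <= t -> exp (- z * cosh t) <= exp (- (z / 2) * t).
Proof.
intros Hz Ht. assert (H : t / 2 <= cosh t).
{ unfold cosh. pose proof (exp_ineq1_le t). pose proof (exp_pos (- t)). lra. }
destruct (Rle_lt_or_eq_dec (- z * cosh t) (- (z / 2) * t) ltac:(nra)) as [L|E].
- left. now apply exp_increasing.
- rewrite E. lra.
Qed.

Lemma RInt_exp_cosh_le (z v : R) :
  0 < z -> 0 <= v -> RInt (fun t => exp (- z * cosh t)) 0 v <= 2 / z.
Proof.
intros Hz Hv.
set (h := fun t => - (2 / z) * exp (- (z / 2) * t)).
assert (I : is_RInt (fun t => exp (- (z / 2) * t)) 0 v (h v - h 0)).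
{ apply (is_RInt_derive (V := R_CompleteNormedModule) h (fun t => exp (- (z / 2) * t))).
  - intros x _. unfold h. auto_derive; [trivial|]. field. lra.
  - intros x _. apply (ex_derive_continuous (V := R_NormedModule)). now auto_derive. }
apply Rle_trans with (RInt (fun t => exp (- (z / 2) * t)) 0 v).
- apply RInt_le; [exact Hv| | |].
  + apply continuous_ex_RInt, continuous_exp_cosh.
  + now exists (h v - h 0).
  + intros x Hx. apply exp_cosh_le; lra.
- rewrite (is_RInt_unique _ _ _ _ I). unfold h. rewrite Rmult_0_r, exp_0.
  assert (0 < 2 / z) by (apply Rdiv_lt_0_compat; lra).
  pose proof (exp_pos (- (z / 2) * v)). nra.
Qed.

Lemma RInt_exp_cosh_incr (z u v : R) :
  u <= v -> RInt (fun t => exp (- z * cosh t)) 0 u <= RInt (fun t => exp (- z * cosh t)) 0 v.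
Proof.
intros H.
rewrite <- (RInt_Chasles (V := R_CompleteNormedModule) (fun t => exp (- z * cosh t)) 0 u v)
  by apply continuous_ex_RInt, continuous_exp_cosh.
assert (0 <= RInt (fun t => exp (- z * cosh t)) u v).
{ apply RInt_ge_0; [exact H|apply continuous_ex_RInt, continuous_exp_cosh|].
  intros; left; apply exp_pos. }
unfold plus; simpl. lra.
Qed.

(** [K0] is a total [RInt_gen], meaningful only once the improper integral is known to converge. The
    partial integrals increase and are bounded, so they converge along the integers, and
    monotonicity extends this to a real upper end. *)
Lemma is_lim_RInt_K0 (z : R) :
  0 < z -> is_lim (fun v => RInt (fun t => exp (- z * cosh t)) 0 v) p_infty (K0 z).
Proof.
intros Hz. set (f := fun t => exp (- z * cosh t)). set (Phi := fun v => RInt f 0 v).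
destruct (ex_finite_lim_seq_incr (fun n => Phi (INR n)) (2 / z)) as [l Hl].
{ intros n. apply RInt_exp_cosh_incr. apply le_INR. lia. }
{ intros n. apply RInt_exp_cosh_le; [exact Hz|apply pos_INR]. }
assert (Hup : forall n, Phi (INR n) <= l).
{ intros n. apply (is_lim_seq_incr_compare _ _ Hl).
  intros m. apply RInt_exp_cosh_incr. apply le_INR. lia. }
assert (HL : is_lim Phi p_infty l).
{ apply is_lim_spec. intros eps. apply is_lim_seq_spec in Hl. destruct (Hl eps) as [N HN].
  exists (INR N). intros v Hv. specialize (HN N (le_n _)).
  assert (Phi (INR N) <= Phi v) by (apply RInt_exp_cosh_incr; lra).
  assert (Phi v <= l).
  { destruct (INR_unbounded v) as [M HM].
    eapply Rle_trans; [apply (RInt_exp_cosh_incr z v (INR M)); lra|apply Hup]. }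
  apply Rabs_def2 in HN. apply Rabs_def1; lra. }
replace (K0 z) with l; [exact HL|].
symmetry. unfold K0. fold f. apply (is_RInt_gen_unique (V := R_CompleteNormedModule)).
intros P HP. apply (Filter_prod _ _ _ (fun a => a = 0) (fun b => P (Phi b))).
- reflexivity.
- exact (HL P HP).
- intros a b -> Hb. exists (Phi b). split; [|exact Hb].
  apply (RInt_correct (V := R_CompleteNormedModule)).
  apply continuous_ex_RInt. intros; apply continuous_exp_cosh.
Qed.

(** The shift moves the window to [-n + s, n + s]. Split at 0, each half tends to [K0 z] because
    cosh is even. *)
Lemma line_integral_K0 (z s : R) :
  0 < z -> line_integral (fun u => exp (- z * cosh (u + s))) (2 * K0 z).
Proof.
intros Hz. set (f := fun t => exp (- z * cosh t)).
assert (Hc : forall x, continuous f x) by (intros; apply continuous_exp_cosh).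
split.
- intros x. apply (continuous_comp (fun u => u + s) f); [|apply Hc].
  apply (ex_derive_continuous (V := R_NormedModule)). now auto_derive.
- apply (is_lim_seq_ext (fun n => RInt f 0 (INR n + s) + RInt f 0 (INR n - s))).
  + intros n. symmetry.
    transitivity (RInt f (- INR n + s) (INR n + s)).
    { pose proof (RInt_comp_lin f 1 s (- INR n) (INR n)) as E. rewrite !Rmult_1_l in E.
      rewrite <- E.
      - apply RInt_ext. intros x _. unfold scal; simpl. unfold mult; simpl.
        unfold f. now rewrite !Rmult_1_l.
      - now apply continuous_ex_RInt. }
    rewrite <- (RInt_Chasles (V := R_CompleteNormedModule) f _ 0 _) by now apply continuous_ex_RInt.
    unfold plus; simpl. rewrite Rplus_comm. f_equal.
    pose proof (RInt_comp_lin f (-1) 0 0 (INR n - s)) as E.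
    replace (-1 * 0 + 0) with 0 in E by ring.
    replace (-1 * (INR n - s) + 0) with (- INR n + s) in E by ring.
    rewrite <- (opp_RInt_swap (V := R_CompleteNormedModule) f) by now apply continuous_ex_RInt.
    rewrite <- E by now apply continuous_ex_RInt.
    rewrite <- (RInt_opp (V := R_CompleteNormedModule)).
    * apply RInt_ext. intros x _. unfold opp, scal; simpl. unfold mult; simpl. unfold f.
      assert (E0 : cosh (- x) = cosh x) by (unfold cosh; rewrite Ropp_involutive; field).
      replace (-1 * x + 0) with (- x) by ring. rewrite E0. ring.
    * apply continuous_ex_RInt. intros x. apply (continuous_scal_r (-1) (fun y => f (-1 * y + 0))).
      apply (continuous_comp (fun u => -1 * u + 0) f); [|apply Hc].
      apply (ex_derive_continuous (V := R_NormedModule)). now auto_derive.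
  + replace (2 * K0 z) with (K0 z + K0 z) by ring.
    assert (HL := is_lim_RInt_K0 z Hz). fold f in HL.
    apply is_lim_seq_plus'.
    * apply (is_lim_comp_seq (fun v => RInt f 0 v) (fun n => INR n + s) p_infty); [exact HL| |].
      -- exists 0%nat. intros; discriminate.
      -- apply (is_lim_seq_plus _ _ p_infty s);
           [apply is_lim_seq_INR|apply is_lim_seq_const|reflexivity].
    * apply (is_lim_comp_seq (fun v => RInt f 0 v) (fun n => INR n - s) p_infty); [exact HL| |].
      -- exists 0%nat. intros; discriminate.
      -- apply (is_lim_seq_minus _ _ p_infty s);
           [apply is_lim_seq_INR|apply is_lim_seq_const|reflexivity].
Qed.

(** m e^u + n e^(-u) = 2 sqrt(mn) cosh(u + s) with s = ln(m/n) / 2. *)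
Lemma line_integral_bessel (c m n : R) :
  0 < c -> 0 < m -> 0 < n ->
  line_integral (fun u => exp (- (m * (c * exp u))) * exp (- (n * (c * exp (- u)))))
                (2 * K0 (2 * c * sqrt (m * n))).
Proof.
intros Hc Hm Hn.
assert (Hmn : 0 < m * n) by nra. pose proof (sqrt_lt_R0 _ Hmn) as Hs.
apply (line_integral_ext (fun u => exp (- (2 * c * sqrt (m * n)) * cosh (u + ln (m / n) / 2)))).
- intros u. rewrite <- exp_plus. f_equal.
  set (s := ln (m / n) / 2).
  assert (Els : ln (sqrt (m * n)) = ln (m * n) / 2).
  { rewrite <- (sqrt_sqrt (m * n)) at 2 by lra. rewrite ln_mult by assumption. field. }
  assert (E1 : sqrt (m * n) * exp s = m).
  { rewrite <- (exp_ln (sqrt (m * n)) Hs), <- exp_plus.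
    rewrite Els. unfold s. rewrite ln_div, ln_mult by assumption.
    replace ((ln m + ln n) / 2 + (ln m - ln n) / 2) with (ln m) by field. now apply exp_ln. }
  assert (E2 : sqrt (m * n) * exp (- s) = n).
  { rewrite <- (exp_ln (sqrt (m * n)) Hs), <- exp_plus.
    rewrite Els. unfold s. rewrite ln_div, ln_mult by assumption.
    replace ((ln m + ln n) / 2 + - ((ln m - ln n) / 2)) with (ln n) by field. now apply exp_ln. }
  unfold cosh. replace (- (u + s)) with (- u + - s) by ring. rewrite !exp_plus.
  rewrite <- E1 at 2. rewrite <- E2 at 3. field.
- apply line_integral_K0. nra.
Qed.

(** * The logarithmic integral *)

Lemma continuous_pf_exp (c K L x : R) :
  0 < c -> 0 < K -> 0 < L ->
  continuous (fun u => 4 * c ^ 2 / ((c ^ 2 * exp (2 * u) + K ^ 2) * (c ^ 2 * exp (-2 * u) + L ^ 2))) x.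
Proof.
intros Hc HK HL. apply (ex_derive_continuous (V := R_NormedModule)). auto_derive.
pose proof (pow_lt c 2 Hc). pose proof (pow_lt K 2 HK). pose proof (pow_lt L 2 HL).
pose proof (exp_pos (2 * x)). pose proof (exp_pos (-2 * x)).
apply Rgt_not_eq. simpl in *. apply Rmult_lt_0_compat; nra.
Qed.

(** In the variable w = e^(2u) the integrand becomes 2 c^2 / ((c^2 w + K^2) (L^2 w + c^2)) dw. The
    last hypothesis says that the two linear factors are not proportional; [k] and [H] in the proof
    are the resulting partial fraction constant and primitive. *)
Lemma line_integral_log (c K L : R) :
  0 < c -> 0 < K -> 0 < L -> (K * L) ^ 2 <> c ^ 4 ->
  line_integral
    (fun u => 4 * c ^ 2 / ((c ^ 2 * exp (2 * u) + K ^ 2) * (c ^ 2 * exp (-2 * u) + L ^ 2)))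
    (2 * c ^ 2 / ((K * L) ^ 2 - c ^ 4) * (2 * ln (K * L / c ^ 2))).
Proof.
intros Hc HK HL Hne. split; [intros; now apply continuous_pf_exp|].
pose proof (pow_lt c 2 Hc) as Hc2. pose proof (pow_lt K 2 HK) as HK2. pose proof (pow_lt L 2 HL) as HL2.
set (k := 2 * c ^ 2 / ((K * L) ^ 2 - c ^ 4)).
set (H := fun u => k * (ln (L ^ 2 * exp (2 * u) + c ^ 2) - ln (c ^ 2 * exp (2 * u) + K ^ 2))).
(* Factoring [/ e n] out of both logarithms at the upper end makes the divergent parts cancel; every
   remaining argument has a positive limit. *)
set (e := fun n : nat => exp (-2 * INR n)).
assert (He : forall n, 0 < e n) by (intros; apply exp_pos).
apply (is_lim_seq_ext (fun n => k * (ln (L ^ 2 + c ^ 2 * e n) - ln (c ^ 2 + K ^ 2 * e n)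
   - (ln (L ^ 2 * e n + c ^ 2) - ln (c ^ 2 * e n + K ^ 2))))).
- intros n. symmetry. transitivity (H (INR n) - H (- INR n)).
  + apply is_RInt_unique.
    apply (is_RInt_derive (V := R_CompleteNormedModule) H).
    * intros x _. unfold H. pose proof (exp_pos (2 * x)) as Hx.
      auto_derive.
      -- simpl in *. split; [nra|split; [nra|trivial]].
      -- unfold k. replace (-2 * x) with (- (2 * x)) by ring. rewrite exp_Ropp.
         assert ((K * L) ^ 2 - c ^ 4 <> 0) by lra.
         field. repeat split; try nra.
    * intros x _. now apply continuous_pf_exp.
  + unfold H.
    assert (E0 : exp (2 * - INR n) = e n) by (unfold e; f_equal; ring).
    assert (E1 : exp (2 * INR n) = / e n).
    { unfold e. rewrite <- exp_Ropp. f_equal. ring. }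
    rewrite E0, E1. specialize (He n).
    replace (L ^ 2 * / e n + c ^ 2) with ((L ^ 2 + c ^ 2 * e n) / e n) by (field; lra).
    replace (c ^ 2 * / e n + K ^ 2) with ((c ^ 2 + K ^ 2 * e n) / e n) by (field; lra).
    rewrite !ln_div by nra. ring.
- assert (Hlim : is_lim_seq e 0).
  { apply (is_lim_comp_seq exp (fun n => -2 * INR n) m_infty 0).
    - apply is_lim_exp_m.
    - exists 0%nat. intros; discriminate.
    - replace m_infty with (Rbar_mult (-2) p_infty).
      + apply is_lim_seq_scal_l, is_lim_seq_INR.
      + simpl. destruct (Rle_dec 0 (-2)) as [r|r]; [exfalso; lra|reflexivity]. }
  assert (Hln : forall a b, 0 < a -> is_lim_seq (fun n => ln (a + b * e n)) (ln a)).
  { intros a b Ha. apply (is_lim_seq_continuous ln (fun n => a + b * e n) a).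
    - apply continuity_pt_filterlim. now apply continuous_ln.
    - replace (Finite a) with (Finite (a + b * 0)) by (f_equal; ring).
      apply is_lim_seq_plus'; [apply is_lim_seq_const|].
      apply (is_lim_seq_scal_l e b 0 Hlim). }
  replace (2 * ln (K * L / c ^ 2)) with (ln (L ^ 2) - ln (c ^ 2) - (ln (c ^ 2) - ln (K ^ 2))).
  2:{ rewrite ln_div, ln_mult by nra.
      replace (L ^ 2) with (L * L) by ring. replace (K ^ 2) with (K * K) by ring.
      rewrite !ln_mult by assumption. ring. }
  match goal with |- is_lim_seq _ (Finite (k * ?v)) =>
    apply (is_lim_seq_scal_l _ k v) end.
  apply is_lim_seq_minus'; apply is_lim_seq_minus'.
  + now apply Hln.
  + now apply Hln.
  + apply (is_lim_seq_ext (fun n => ln (c ^ 2 + L ^ 2 * e n))); [intros; f_equal; ring|now apply Hln].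
  + apply (is_lim_seq_ext (fun n => ln (K ^ 2 + c ^ 2 * e n))); [intros; f_equal; ring|now apply Hln].
Qed.

Lemma line_integral_pf (c v w : R) :
  0 < c -> 0 < v -> 0 < w -> 4 * PI ^ 2 * (v * w) <> c ^ 2 ->
  line_integral (fun u => pf (c * exp u) v * pf (c * exp (- u)) w)
    (4 * c ^ 2 * ln (4 * PI ^ 2 * (v * w) / c ^ 2) / ((4 * PI ^ 2 * (v * w)) ^ 2 - c ^ 4)).
Proof.
intros Hc Hv Hw Hne. pose proof PI_RGT_0 as HPI.
assert (H4 : 0 < 4 * PI ^ 2 * (v * w)).
{ apply Rmult_lt_0_compat; [pose proof (pow_lt PI 2 HPI); lra|nra]. }
assert (Hne' : (4 * PI ^ 2 * (v * w)) ^ 2 <> c ^ 4).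
{ intros E. apply Hne. pose proof (pow_lt c 2 Hc).
  replace (c ^ 4) with ((c ^ 2) ^ 2) in E by ring.
  set (A := 4 * PI ^ 2 * (v * w)) in *. set (B := c ^ 2) in *.
  assert ((A - B) * (A + B) = 0) by lra.
  apply Rmult_integral in H0. lra. }
replace (4 * PI ^ 2 * (v * w)) with (2 * PI * v * (2 * PI * w)) in * by ring.
replace (4 * c ^ 2 * ln (2 * PI * v * (2 * PI * w) / c ^ 2) / ((2 * PI * v * (2 * PI * w)) ^ 2 - c ^ 4))
  with (2 * c ^ 2 / ((2 * PI * v * (2 * PI * w)) ^ 2 - c ^ 4)
        * (2 * ln (2 * PI * v * (2 * PI * w) / c ^ 2))) by (field; lra).
assert (HK : 0 < 2 * PI * v) by nra. assert (HL : 0 < 2 * PI * w) by nra.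
eapply line_integral_ext; [|apply line_integral_log; [exact Hc|exact HK|exact HL|exact Hne']].
intros u. unfold pf. set (K := 2 * PI * v) in *. set (L := 2 * PI * w) in *.
assert (E : exp (-2 * u) = exp (- u) ^ 2).
{ replace (-2 * u) with (- u + - u) by ring. rewrite exp_plus. ring. }
assert (E' : exp (2 * u) = exp u ^ 2).
{ replace (2 * u) with (u + u) by ring. rewrite exp_plus. ring. }
rewrite E, E', !exp_Ropp. pose proof (exp_pos u).
pose proof (pow_lt c 2 Hc). pose proof (pow_lt K 2 HK). pose proof (pow_lt L 2 HL).
pose proof (pow_lt (exp u) 2 H).
field. repeat split; nra.
Qed.

(** * Limits of complex sequences *)

Definition clim (u : nat -> C) (l : C) : Prop := is_lim_seq (fun n => Cmod (u n - l)%C) 0.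

Lemma clim_squeeze (u : nat -> C) (l : C) (e : nat -> R) :
  (forall n, Cmod (u n - l)%C <= e n) -> is_lim_seq e 0 -> clim u l.
Proof.
intros H He. apply (is_lim_seq_le_le (fun _ => 0) _ e 0); [|apply is_lim_seq_const|exact He].
intros n. split; [apply Cmod_ge_0|apply H].
Qed.

Lemma clim_ext (u v : nat -> C) (l : C) : (forall n, u n = v n) -> clim u l -> clim v l.
Proof. intros E. apply is_lim_seq_ext. intros n. now rewrite E. Qed.

Lemma clim_const (l : C) : clim (fun _ => l) l.
Proof.
apply (is_lim_seq_ext (fun _ => 0)); [|apply is_lim_seq_const].
intros _. replace (l - l)%C with (RtoC 0) by ring. now rewrite Cmod_0.
Qed.

Lemma clim_plus (u v : nat -> C) (l m : C) :
  clim u l -> clim v m -> clim (fun n => u n + v n)%C (l + m)%C.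
Proof.
intros Hu Hv. apply (clim_squeeze _ _ (fun n => Cmod (u n - l)%C + Cmod (v n - m)%C)).
- intros n. replace (u n + v n - (l + m))%C with ((u n - l) + (v n - m))%C by ring.
  apply Cmod_triangle.
- replace (Finite 0) with (Finite (0 + 0)) by (f_equal; ring). now apply is_lim_seq_plus'.
Qed.

Lemma clim_mult_l (c : C) (u : nat -> C) (l : C) :
  clim u l -> clim (fun n => c * u n)%C (c * l)%C.
Proof.
intros Hu. apply (clim_squeeze _ _ (fun n => Cmod c * Cmod (u n - l)%C)).
- intros n. rewrite <- Cmod_mult. right. f_equal. ring.
- replace (Finite 0) with (Rbar_mult (Cmod c) 0) by (simpl; f_equal; ring).
  now apply is_lim_seq_scal_l.
Qed.

Lemma clim_mult (u v : nat -> C) (l m : C) :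
  clim u l -> clim v m -> clim (fun n => u n * v n)%C (l * m)%C.
Proof.
intros Hu Hv.
apply (clim_squeeze _ _ (fun n => Cmod (u n - l)%C * Cmod (v n - m)%C
   + Cmod m * Cmod (u n - l)%C + Cmod l * Cmod (v n - m)%C)).
- intros n. rewrite <- !Cmod_mult.
  replace (u n * v n - l * m)%C
    with ((u n - l) * (v n - m) + m * (u n - l) + l * (v n - m))%C by ring.
  eapply Rle_trans; [apply Cmod_triangle|]. apply Rplus_le_compat_r, Cmod_triangle.
- replace (Finite 0) with (Finite (0 * 0 + Cmod m * 0 + Cmod l * 0)) by (f_equal; ring).
  apply is_lim_seq_plus'; [apply is_lim_seq_plus'|].
  + now apply is_lim_seq_mult'.
  + apply (is_lim_seq_scal_l _ (Cmod m) 0 Hu).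
  + apply (is_lim_seq_scal_l _ (Cmod l) 0 Hv).
Qed.

Lemma clim_csum (u : nat -> nat -> C) (l : nat -> C) (n : nat) :
  (forall i, (i < n)%nat -> clim (fun k => u k i) (l i)) ->
  clim (fun k => csum (u k) n) (csum l n).
Proof.
induction n as [|n IH]; intros H; simpl; [apply clim_const|].
apply clim_plus; [apply IH; intros; apply H; lia|apply H; lia].
Qed.

Lemma clim_RtoC (u : nat -> R) (l : R) :
  is_lim_seq u l -> clim (fun n => RtoC (u n)) (RtoC l).
Proof.
intros H. apply (is_lim_seq_ext (fun n => Rabs (u n - l))).
- intros n. now rewrite <- RtoC_minus, Cmod_R.
- replace (Finite 0) with (Rbar_abs (l - l)) by (simpl; f_equal; rewrite Rminus_diag, Rabs_R0; easy).
  apply (is_lim_seq_abs _ (l - l)).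
  apply is_lim_seq_minus'; [exact H|apply is_lim_seq_const].
Qed.

Lemma Cmod_lim_le (u : nat -> C) (l z : C) (B : R) (k0 : nat) :
  clim u l -> (forall k, (k0 <= k)%nat -> Cmod (u k - z)%C <= B) -> Cmod (l - z)%C <= B.
Proof.
intros Hu H. rewrite <- (Rplus_0_l B).
apply (is_lim_seq_le_loc (fun _ => Cmod (l - z)%C) (fun k => Cmod (u k - l)%C + B)
         (Cmod (l - z)%C) (0 + B)).
- exists k0. intros k Hk. specialize (H k Hk).
  replace (l - z)%C with (- (u k - l) + (u k - z))%C by ring.
  eapply Rle_trans; [apply Cmod_triangle|]. rewrite Cmod_opp. lra.
- apply is_lim_seq_const.
- apply is_lim_seq_plus'; [exact Hu|apply is_lim_seq_const].
Qed.

Lemma clim_cauchy (u : nat -> C) (e : nat -> R) :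
  (forall n m, Cmod (u n - u m)%C <= e n + e m) -> is_lim_seq e 0 -> exists l, clim u l.
Proof.
intros H He.
assert (Hc : forall g : C -> R, (forall z, Rabs (g z) <= Cmod z) ->
   (forall z w, g (z - w)%C = g z - g w) -> ex_finite_lim_seq (fun n => g (u n))).
{ intros g Hg Hm. apply ex_lim_seq_cauchy_corr. intros eps.
  apply is_lim_seq_spec in He. destruct (He (pos_div_2 eps)) as [N HN].
  exists N. intros n m Hn Hm'. rewrite <- Hm.
  eapply Rle_lt_trans; [apply Hg|]. eapply Rle_lt_trans; [apply H|].
  pose proof (HN n Hn) as A1. pose proof (HN m Hm') as A2. simpl in A1, A2.
  apply Rabs_def2 in A1. apply Rabs_def2 in A2. lra. }
destruct (Hc Re re_le_Cmod) as [a Ha]. { intros [] []. reflexivity. }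
destruct (Hc Im im_le_Cmod) as [b Hb]. { intros [] []. reflexivity. }
exists (RtoC a + Ci * RtoC b)%C.
apply (clim_ext (fun n => RtoC (Re (u n)) + Ci * RtoC (Im (u n)))%C).
- intros n. destruct (u n) as [x y]. unfold RtoC, Ci, Cplus, Cmult; simpl. f_equal; ring.
- apply clim_plus; [|apply clim_mult_l]; now apply clim_RtoC.
Qed.

Lemma clim_is_series (f : nat -> C) (l : C) : clim (csum f) l -> @is_series C_AbsRing C_NormedModule f l.
Proof.
intros H P [eps HP]. apply is_lim_seq_spec in H. destruct (H eps) as [N HN].
exists N. intros n Hn. apply HP. apply C_NormedModule_mixin_compat1.
change (@sum_n C_NormedModule f n) with (@sum_n C_AbelianMonoid f n).
rewrite sum_n_csum. specialize (HN (S n) ltac:(lia)).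
rewrite Rminus_0_r, Rabs_pos_eq in HN by apply Cmod_ge_0. exact HN.
Qed.

(** * Finite real sums *)

Fixpoint rsum (f : nat -> R) (n : nat) : R :=
  match n with O => 0 | S k => rsum f k + f k end.

Lemma rsum_le (f g : nat -> R) (n : nat) :
  (forall i, (i < n)%nat -> f i <= g i) -> rsum f n <= rsum g n.
Proof.
induction n as [|n IH]; intros H; simpl; [lra|].
apply Rplus_le_compat; [apply IH; intros; apply H; lia|apply H; lia].
Qed.

Lemma rsum_plus (f g : nat -> R) (n : nat) :
  rsum (fun i => f i + g i) n = rsum f n + rsum g n.
Proof. induction n as [|n IH]; simpl; [ring | rewrite IH; ring]. Qed.

Lemma rsum_mult_l (c : R) (f : nat -> R) (n : nat) : rsum (fun i => c * f i) n = c * rsum f n.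
Proof. induction n as [|n IH]; simpl; [ring | rewrite IH; ring]. Qed.

Lemma rsum_mult_r (c : R) (f : nat -> R) (n : nat) : rsum (fun i => f i * c) n = rsum f n * c.
Proof. induction n as [|n IH]; simpl; [ring | rewrite IH; ring]. Qed.

Lemma rsum_ext (f g : nat -> R) (n : nat) :
  (forall i, (i < n)%nat -> f i = g i) -> rsum f n = rsum g n.
Proof.
induction n as [|n IH]; intros H; simpl; [reflexivity|].
rewrite IH by (intros; apply H; lia). rewrite H by lia. reflexivity.
Qed.

Lemma rsum_nonneg (f : nat -> R) (n : nat) : (forall i, 0 <= f i) -> 0 <= rsum f n.
Proof. intros H. induction n as [|n IH]; simpl; [lra|]. specialize (H n). lra. Qed.

Lemma Cmod_csum_le (f : nat -> C) (g : nat -> R) (n : nat) :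
  (forall i, (i < n)%nat -> Cmod (f i) <= g i) -> Cmod (csum f n) <= rsum g n.
Proof.
induction n as [|n IH]; intros H; simpl; [rewrite Cmod_0; lra|].
eapply Rle_trans; [apply Cmod_triangle|].
apply Rplus_le_compat; [apply IH; intros; apply H; lia|apply H; lia].
Qed.

Lemma sum_n_rsum (f : nat -> R) (n : nat) : sum_n f n = rsum f (S n).
Proof.
induction n as [|n IH].
- rewrite sum_O. simpl. ring.
- rewrite sum_Sn, IH. reflexivity.
Qed.

(** * The hyperbola method *)

Definition pow32_inv (i : nat) : R := / sqrt (INR (S i)) ^ 3.

Lemma sqrt_S_pos (i : nat) : 0 < sqrt (INR (S i)).
Proof. apply sqrt_lt_R0, lt_0_INR. lia. Qed.

Lemma pow32_inv_pos (i : nat) : 0 < pow32_inv i.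
Proof. apply Rinv_0_lt_compat, pow_lt, sqrt_S_pos. Qed.

(** Discrete form of the primitive -2/sqrt(x) of x^(-3/2): since t^2 - s^2 = 1, the right side is 2
    / (s t (s + t)), and s (s + t) <= 2 t^2. *)
Lemma pow32_inv_telescope (i : nat) :
  pow32_inv (S i) <= 2 / sqrt (INR (S i)) - 2 / sqrt (INR (S (S i))).
Proof.
unfold pow32_inv. pose proof (sqrt_S_pos i) as Hs. pose proof (sqrt_S_pos (S i)) as Ht.
assert (E : sqrt (INR (S (S i))) ^ 2 = sqrt (INR (S i)) ^ 2 + 1).
{ rewrite !pow2_sqrt by apply pos_INR. now rewrite S_INR. }
assert (L : sqrt (INR (S i)) <= sqrt (INR (S (S i)))).
{ apply sqrt_le_1_alt. apply le_INR. lia. }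
set (s := sqrt (INR (S i))) in *. set (t := sqrt (INR (S (S i)))) in *.
replace (2 / s - 2 / t) with (2 * (t ^ 2 - s ^ 2) / (s * t * (s + t))) by (field; lra).
replace (t ^ 2 - s ^ 2) with 1 by lra.
replace (2 * 1 / (s * t * (s + t))) with (/ (t * (s * (s + t) / 2))) by (field; lra).
apply Rinv_le_contravar.
- apply Rmult_lt_0_compat; nra.
- replace (t ^ 3) with (t * t ^ 2) by ring. apply Rmult_le_compat_l; nra.
Qed.

Lemma pow32_inv_tail (K n : nat) :
  rsum (fun i => if (S K <=? i)%nat then pow32_inv i else 0) n <= 2 / sqrt (INR (S K)).
Proof.
set (T := fun i => if (S K <=? i)%nat then pow32_inv i else 0).
assert (H : rsum T n <= if (S K <=? n)%nat then 2 / sqrt (INR (S K)) - 2 / sqrt (INR n) else 0).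
{ induction n as [|n IH]; [simpl; lra|]. change (rsum T (S n)) with (rsum T n + T n).
  unfold T at 2. revert IH. destruct (Nat.leb_spec (S K) n) as [L|L]; intros IH.
  - destruct (Nat.leb_spec (S K) (S n)) as [L'|L']; [|lia].
    destruct n as [|n]; [lia|]. pose proof (pow32_inv_telescope n). lra.
  - destruct (Nat.leb_spec (S K) (S n)) as [L'|L']; [|lra].
    replace n with K in * by lia. lra. }
pose proof (sqrt_S_pos K) as HK.
assert (0 < 2 / sqrt (INR (S K))) by (apply Rdiv_lt_0_compat; lra).
revert H. destruct (Nat.leb_spec (S K) n) as [L|L]; intros H; [|lra].
destruct n as [|n]; [lia|]. pose proof (sqrt_S_pos n).
assert (0 < 2 / sqrt (INR (S n))) by (apply Rdiv_lt_0_compat; lra). lra.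
Qed.

Lemma rsum_pow32_inv_le (n : nat) : rsum pow32_inv n <= 3.
Proof.
assert (H : rsum pow32_inv n <= 1 + rsum (fun i => if (1 <=? i)%nat then pow32_inv i else 0) n).
{ induction n as [|n IH]; [simpl; lra|]. destruct n as [|n].
  - simpl. unfold pow32_inv. simpl INR. rewrite sqrt_1, pow1, Rinv_1. lra.
  - change (rsum pow32_inv (S n) + pow32_inv (S n)
     <= 1 + (rsum (fun i => if (1 <=? i)%nat then pow32_inv i else 0) (S n) + pow32_inv (S n))).
    lra. }
pose proof (pow32_inv_tail 0 n) as H2. simpl INR in H2. rewrite sqrt_1 in H2. lra.
Qed.

(** 12 = 2 * (2 * 3): either index may be the large one, its tail is at most 2 / sqrt(isqrt N), and
    the full sum over the other index is at most 3. *)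
Definition hyperbola_error (N : nat) : R := 12 / sqrt (INR (Nat.sqrt N)).

Lemma is_lim_hyperbola_error : is_lim_seq hyperbola_error 0.
Proof.
unfold hyperbola_error, Rdiv.
replace (Finite 0) with (Rbar_mult 12 0) by (simpl; f_equal; ring).
apply is_lim_seq_scal_l. apply (is_lim_seq_inv _ p_infty); [|discriminate].
apply (filterlim_comp _ _ _ (fun N => INR (Nat.sqrt N)) sqrt _ (Rbar_locally p_infty));
  [|apply filterlim_sqrt_p].
change (is_lim_seq (fun N => INR (Nat.sqrt N)) p_infty).
apply is_lim_seq_spec. intros M. destruct (INR_unbounded M) as [K HK].
exists (K * K)%nat. intros N HN. eapply Rlt_le_trans; [exact HK|]. apply le_INR.
rewrite <- (Nat.sqrt_square K). now apply Nat.sqrt_le_mono.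
Qed.

(* If (i+1)(j+1) > N then i or j is at least the integer square root of N. *)
Lemma hyperbola_tail (N m n : nat) :
  (1 <= N)%nat ->
  rsum (fun i => rsum (fun j =>
     if (S i * S j <=? N)%nat then 0 else pow32_inv i * pow32_inv j) n) m
  <= hyperbola_error N.
Proof.
intros HN. unfold hyperbola_error.
destruct (Nat.sqrt N) as [|K] eqn:EK.
{ exfalso. pose proof (Nat.sqrt_le_mono 1 N HN) as H. rewrite EK in H. change (Nat.sqrt 1) with 1%nat in H. lia. }
set (T := fun i => if (S K <=? i)%nat then pow32_inv i else 0).
assert (HT0 : forall i, 0 <= T i).
{ intros i. unfold T. destruct (S K <=? i)%nat; [left; apply pow32_inv_pos|lra]. }
apply Rle_trans with (rsum (fun i => rsum (fun j => T i * pow32_inv j + pow32_inv i * T j) n) m).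
- apply rsum_le. intros i _. apply rsum_le. intros j _.
  pose proof (HT0 i). pose proof (HT0 j).
  pose proof (pow32_inv_pos i). pose proof (pow32_inv_pos j).
  destruct (Nat.leb_spec (S i * S j) N) as [L|L]; [nra|].
  assert (Hsq : (S K * S K <= N)%nat) by (rewrite <- EK; apply Nat.sqrt_specif).
  assert (HH : (S K <= i \/ S K <= j)%nat).
  { destruct (Nat.le_gt_cases (S K) i); [now left|].
    destruct (Nat.le_gt_cases (S K) j); [now right|]. exfalso.
    assert (S i * S j <= S K * S K)%nat by (apply Nat.mul_le_mono; lia). lia. }
  assert (HTi : forall k, (S K <= k)%nat -> T k = pow32_inv k).
  { intros k Hk. apply Nat.leb_le in Hk. unfold T. now rewrite Hk. }
  destruct HH as [HH|HH]; rewrite (HTi _ HH); nra.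
- rewrite (rsum_ext _ (fun i => T i * rsum pow32_inv n + pow32_inv i * rsum T n)).
  2:{ intros i _. now rewrite rsum_plus, !rsum_mult_l. }
  rewrite rsum_plus, !rsum_mult_r.
  pose proof (pow32_inv_tail K m) as A1. pose proof (pow32_inv_tail K n) as A2. fold T in A1, A2.
  pose proof (rsum_pow32_inv_le m) as A3. pose proof (rsum_pow32_inv_le n) as A4.
  pose proof (rsum_nonneg T m HT0). pose proof (rsum_nonneg T n HT0).
  pose proof (rsum_nonneg pow32_inv m (fun i => Rlt_le _ _ (pow32_inv_pos i))).
  pose proof (rsum_nonneg pow32_inv n (fun i => Rlt_le _ _ (pow32_inv_pos i))).
  set (t := sqrt (INR (S K))) in *.
  replace (12 / t) with (2 / t * 3 + 3 * (2 / t)) by (unfold Rdiv; ring).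
  apply Rplus_le_compat; apply Rmult_le_compat; assumption.
Qed.

Definition hyperbola_sum (N : nat) (F : nat -> nat -> C) : C :=
  csum (fun i => csum (fun j => if (S i * S j <=? N)%nat then F i j else RtoC 0) N) N.

Lemma hyperbola_sum_rect (N m n : nat) (F : nat -> nat -> C) :
  (N <= m)%nat -> (N <= n)%nat ->
  hyperbola_sum N F
  = csum (fun i => csum (fun j => if (S i * S j <=? N)%nat then F i j else RtoC 0) n) m.
Proof.
intros Hm Hn. unfold hyperbola_sum. symmetry. rewrite (csum_extend _ N m Hm).
- apply csum_ext. intros i _. apply csum_extend; [exact Hn|].
  intros j Hj. destruct (Nat.leb_spec (S i * S j) N); [nia|reflexivity].
- intros i Hi. apply csum_0. intros j _.
  destruct (Nat.leb_spec (S i * S j) N); [nia|reflexivity].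
Qed.

(** The limits are taken along whole periods, so the hyperbola is compared with boxes of sides
    [p * k] and [q * k]. For k >= N such a box contains it, and the excess is bounded independently
    of [k]. *)
Lemma hyperbola_approx (f g : nat -> C) (F G : C) (p q : nat) (B : R) (N : nat) :
  (1 <= p)%nat -> (1 <= q)%nat -> (1 <= N)%nat ->
  clim (fun k => csum f (p * k)) F -> clim (fun k => csum g (q * k)) G ->
  0 <= B ->
  (forall i j, Cmod (f i * g j)%C <= B * (pow32_inv i * pow32_inv j)) ->
  Cmod (F * G - hyperbola_sum N (fun i j => f i * g j))%C <= B * hyperbola_error N.
Proof.
intros Hp Hq HN HF HG HB H.
apply (Cmod_lim_le _ _ _ _ N (clim_mult _ _ _ _ HF HG)).
intros k Hk. rewrite (hyperbola_sum_rect N (p * k) (q * k)) by nia.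
rewrite <- csum_mult_r, <- csum_minus.
apply Rle_trans with (rsum (fun i => rsum (fun j =>
   B * (if (S i * S j <=? N)%nat then 0 else pow32_inv i * pow32_inv j)) (q * k)) (p * k)).
- apply Cmod_csum_le. intros i _. rewrite <- csum_mult_l, <- csum_minus.
  apply Cmod_csum_le. intros j _. destruct (S i * S j <=? N)%nat.
  + replace (f i * g j - f i * g j)%C with (RtoC 0) by ring. rewrite Cmod_0. lra.
  + replace (f i * g j - 0)%C with (f i * g j)%C by ring. apply H.
- rewrite (rsum_ext _ (fun i => B * rsum (fun j =>
   if (S i * S j <=? N)%nat then 0 else pow32_inv i * pow32_inv j) (q * k))).
  2:{ intros i _. apply rsum_mult_l. }
  rewrite rsum_mult_l. apply Rmult_le_compat_l; [exact HB|]. now apply hyperbola_tail.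
Qed.

Lemma dchi_rect (c1 c2 : nat -> C) (N n : nat) :
  (n < N)%nat ->
  dchi c1 c2 (S n)
  = csum (fun i => csum (fun j =>
      if (S i * S j =? S n)%nat then c1 (S i) * c2 (S j) else RtoC 0)%C N) N.
Proof.
intros Hn. unfold dchi. rewrite sum_n_m_csum.
rewrite <- (csum_extend _ (S n) N).
- apply csum_ext. intros i _.
  destruct (Nat.eqb_spec (S n mod S i) 0) as [E|E].
  + apply Nat.Div0.mod_divides in E. destruct E as [d Ed].
    destruct d as [|d]; [lia|].
    rewrite (csum_single _ N d).
    * rewrite Ed at 2. rewrite Nat.eqb_refl.
      rewrite Ed, Nat.mul_comm, Nat.div_mul by lia. reflexivity.
    * nia.
    * intros j _ Hj. destruct (Nat.eqb_spec (S i * S j) (S n)) as [E|E]; [nia|reflexivity].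
  + rewrite csum_0; [reflexivity|]. intros j _.
    destruct (Nat.eqb_spec (S i * S j) (S n)) as [E'|E']; [|reflexivity].
    exfalso. apply E. apply Nat.Div0.mod_divides. exists (S j). lia.
- lia.
- intros i Hi. rewrite Nat.mod_small by lia. reflexivity.
Qed.

Lemma csum_dchi (c1 c2 h : nat -> C) (N : nat) :
  csum (fun n => dchi c1 c2 (S n) * h (S n))%C N
  = hyperbola_sum N (fun i j => c1 (S i) * c2 (S j) * h (S i * S j)%nat)%C.
Proof.
rewrite (csum_ext _ (fun n => csum (fun i => csum (fun j =>
   (if (S i * S j =? S n)%nat then c1 (S i) * c2 (S j) else RtoC 0) * h (S n)) N) N)%C).
2:{ intros n Hn. rewrite (dchi_rect c1 c2 N n Hn), <- csum_mult_r.
    apply csum_ext. intros i _. now rewrite <- csum_mult_r. }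
rewrite csum_swap. apply csum_ext. intros i _. rewrite csum_swap. apply csum_ext. intros j _.
destruct (Nat.leb_spec (S i * S j) N) as [L|L].
- rewrite (csum_single _ N (S i * S j - 1)).
  + replace (S (S i * S j - 1)) with (S i * S j)%nat by lia. now rewrite Nat.eqb_refl.
  + lia.
  + intros n _ Hn. destruct (Nat.eqb_spec (S i * S j) (S n)) as [E|E]; [lia|ring].
- apply csum_0. intros n Hn.
  destruct (Nat.eqb_spec (S i * S j) (S n)) as [E|E]; [lia|ring].
Qed.

(** * Pointwise limits of the twisted kernels *)

Lemma csum_shift (f : nat -> C) (n : nat) :
  f 0%nat = f n -> csum (fun i => f (S i)) n = csum f n.
Proof.
intros E. rewrite <- (csum_reflect f n E), (csum_rev (fun i => f (S i))).
apply csum_ext. intros i Hi. f_equal. lia.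
Qed.

(** For y > 0, the sum of chi(m) e^(-my) over all m: one period divided by 1 - e^(-qy). *)
Definition char_exp_limit (q : nat) (chi : nat -> C) (y : R) : C :=
  (csum (fun m => chi m * RtoC (exp (- y) ^ m)) q / RtoC (1 - exp (- y) ^ q))%C.

Definition char_pf_limit (q : nat) (chi : nat -> C) (y : R) : C :=
  csum (fun h => Cconj (chi h) * RtoC (pf_sum y (INR h / INR q)))%C q.

Lemma exp_neg_pow_lt_1 (y : R) (q : nat) : 0 < y -> (1 <= q)%nat -> 0 < exp (- y) ^ q < 1.
Proof.
intros Hy Hq. pose proof (exp_pos (- y)) as H0.
assert (H1 : exp (- y) < 1) by (rewrite <- exp_0; apply exp_increasing; lra).
split; [now apply pow_lt|]. destruct q as [|q]; [lia|]. simpl.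
assert (exp (- y) ^ q <= 1) by (rewrite <- (pow1 q); apply pow_incr; lra).
pose proof (pow_lt _ q H0). nra.
Qed.

Lemma exp_neg_pow (y : R) (n : nat) : exp (- (INR n * y)) = exp (- y) ^ n.
Proof.
induction n as [|n IH].
- simpl. rewrite Rmult_0_l, Ropp_0. apply exp_0.
- rewrite S_INR. replace (- ((INR n + 1) * y)) with (- y + - (INR n * y)) by ring.
  now rewrite exp_plus, IH.
Qed.

Lemma clim_char_exp (q : nat) (chi : nat -> C) (y : R) :
  dirichlet_char q chi -> (1 < q)%nat -> 0 < y ->
  clim (fun k => csum (fun i => chi (S i) * RtoC (exp (- (INR (S i) * y))))%C (q * k))
       (char_exp_limit q chi y).
Proof.
intros Hc Hq Hy. set (r := exp (- y)). set (A := csum (fun m => chi m * RtoC (r ^ m))%C q).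
pose proof (exp_neg_pow_lt_1 y q Hy ltac:(lia)) as Hr. fold r in Hr.
assert (Hz := char_0 q chi Hc Hq).
assert (Hne : RtoC (1 - r ^ q) <> RtoC 0) by (intros E; injection E as E; lra).
(* Over [k] periods the partial sum is exactly the limit times 1 - r^(qk). *)
apply (clim_ext (fun k => char_exp_limit q chi y * RtoC (1 - (r ^ q) ^ k))%C).
- intros k.
  rewrite (csum_ext _ (fun i => (fun m => chi m * RtoC (r ^ m))%C (S i))).
  2:{ intros i _. f_equal. f_equal. apply exp_neg_pow. }
  rewrite (csum_shift (fun m => chi m * RtoC (r ^ m))%C).
  2:{ replace (q * k)%nat with (0 + k * q)%nat by lia. rewrite char_add_mul by exact Hc.
      rewrite Hz. ring. }
  rewrite csum_mul.
  rewrite (csum_ext _ (fun j => RtoC (r ^ q) ^ j * A)%C).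
  2:{ intros j _. unfold A. rewrite <- csum_mult_l. apply csum_ext. intros h _.
      rewrite Nat.add_comm, char_add_mul by exact Hc.
      rewrite pow_add, (Nat.mul_comm j q), pow_mult, RtoC_mult, <- (RtoC_pow (r ^ q) j). ring. }
  rewrite csum_mult_r. unfold char_exp_limit. fold r. fold A.
  pose proof (csum_pow (RtoC (r ^ q)) k) as E.
  rewrite <- RtoC_pow, <- !RtoC_minus in E.
  rewrite <- E. change (csum (Cpow (RtoC (r ^ q))) k) with (csum (fun m => RtoC (r ^ q) ^ m)%C k).
  field. exact Hne.
- replace (char_exp_limit q chi y) with (char_exp_limit q chi y * RtoC 1)%C at 1 by ring.
  apply clim_mult_l, clim_RtoC.
  replace (Finite 1) with (Finite (1 - 0)) by (f_equal; ring).
  apply is_lim_seq_minus'; [apply is_lim_seq_const|].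
  apply is_lim_seq_geom. rewrite Rabs_pos_eq; lra.
Qed.

Lemma RtoC_rsum (f : nat -> R) (n : nat) : RtoC (rsum f n) = csum (fun i => RtoC (f i)) n.
Proof. induction n as [|n IH]; simpl; [reflexivity|]. now rewrite RtoC_plus, IH. Qed.

Lemma is_lim_rsum (f : nat -> R) : ex_series f -> is_lim_seq (rsum f) (Series f).
Proof.
intros H. apply is_lim_seq_incr_1. apply (is_lim_seq_ext (sum_n f)).
- intros n. apply sum_n_rsum.
- exact (Series_correct f H).
Qed.

Lemma clim_char_pf (q : nat) (chi : nat -> C) (y : R) :
  dirichlet_char q chi -> (1 < q)%nat -> 0 < y ->
  clim (fun k => csum (fun i => conj_char chi (S i) * RtoC (pf y (INR (S i) / INR q)))%C (q * k))
       (char_pf_limit q chi y).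
Proof.
intros Hc Hq Hy. assert (Hz := char_0 q chi Hc Hq).
assert (HIq : 0 < INR q) by (apply lt_0_INR; lia).
apply (clim_ext (fun k => csum (fun h =>
   Cconj (chi h) * RtoC (rsum (fun j => pf y (INR j + INR h / INR q)) k))%C q)).
- intros k.
  rewrite (csum_shift (fun m => conj_char chi m * RtoC (pf y (INR m / INR q)))%C).
  2:{ unfold conj_char. replace (q * k)%nat with (0 + k * q)%nat at 1 by lia.
      rewrite char_add_mul by exact Hc. rewrite Hz.
      replace (Cconj (RtoC 0)) with (RtoC 0) by (unfold Cconj, RtoC; simpl; f_equal; ring).
      ring. }
  rewrite csum_mul, csum_swap. apply csum_ext. intros h _.
  rewrite RtoC_rsum, <- csum_mult_l. apply csum_ext. intros j _. unfold conj_char.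
  rewrite Nat.add_comm, char_add_mul by exact Hc. f_equal. f_equal. f_equal.
  rewrite plus_INR, mult_INR. field. lra.
- apply clim_csum. intros h _. apply clim_mult_l, clim_RtoC. apply is_lim_rsum.
  apply ex_series_pf; [exact Hy|]. apply Rdiv_le_0_compat; [apply pos_INR|exact HIq].
Qed.

(** Evenness pairs h with q - h, so twice the half-lattice sum is a full lattice sum, hence a sum of
    Poisson kernels to which [char_poisson_sum] applies. *)
Lemma char_exp_limit_eq (q : nat) (chi : nat -> C) (y : R) :
  primitive_char q chi -> (1 < q)%nat -> even_char q chi -> 0 < y ->
  char_exp_limit q chi y = (gauss_sum q chi / RtoC (INR q) * char_pf_limit q chi y)%C.
Proof.
intros Hprim Hq He Hy. pose proof Hprim as [Hc _].
assert (HIq : 0 < INR q) by (apply lt_0_INR; lia).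
pose proof (exp_neg_pow_lt_1 y q Hy ltac:(lia)) as Hr.
assert (E2 : (RtoC 2 * char_pf_limit q chi y)%C
  = csum (fun h => Cconj (chi h) * RtoC (poisson y (INR h / INR q)))%C q).
{ set (f := fun h => (Cconj (chi h) * RtoC (pf_sum y (INR h / INR q)))%C).
  assert (Ef : csum (fun h => f (q - h)%nat) q = csum f q).
  { apply csum_reflect. unfold f. replace q with (0 + 1 * q)%nat at 2 by lia.
    rewrite char_add_mul by exact Hc. rewrite (char_0 q chi Hc Hq).
    replace (Cconj (RtoC 0)) with (RtoC 0) by (unfold Cconj, RtoC; simpl; f_equal; ring).
    ring. }
  replace (RtoC 2 * char_pf_limit q chi y)%C with (csum f q + csum (fun h => f (q - h)%nat) q)%C.
  2:{ rewrite Ef. unfold char_pf_limit. fold f. ring. }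
  rewrite <- csum_plus. apply csum_ext. intros h Hh. unfold f.
  rewrite even_char_reflect by (assumption || lia).
  assert (Hhq : 0 <= INR h / INR q <= 1).
  { split; [apply Rdiv_le_0_compat; [apply pos_INR|exact HIq]|].
    apply Rmult_le_reg_r with (INR q); [exact HIq|]. unfold Rdiv.
    rewrite Rmult_assoc, Rinv_l by lra. rewrite Rmult_1_r, Rmult_1_l. apply le_INR. lia. }
  rewrite (poisson_partial_fractions y _ Hy Hhq), minus_INR by lia.
  replace ((INR q - INR h) / INR q) with (1 - INR h / INR q) by (field; lra).
  rewrite RtoC_plus. ring. }
pose proof (char_poisson_sum y q chi Hprim Hq He Hy) as E. rewrite <- E2 in E.
unfold char_exp_limit.
assert (H1 : RtoC (1 - exp (- y) ^ q) <> RtoC 0) by (intros D; injection D as D; lra).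
assert (H2 : RtoC (INR q) <> RtoC 0) by (intros D; injection D as D; lra).
assert (H3 : RtoC 2 <> RtoC 0) by (intros D; injection D as D; lra).
set (A := csum (fun m => chi m * RtoC (exp (- y) ^ m))%C q) in *.
replace A with (RtoC (2 * INR q) * A / (RtoC 2 * RtoC (INR q)))%C.
- rewrite <- E. field. auto.
- rewrite RtoC_mult. field. auto.
Qed.

(** * Uniform bounds for the kernels *)

(** The square of e^t >= 1 + t at t = z^2/2. Its expansion 1 + z^2 + z^4/4 dominates both z^3/2 and
    z^4/4 for z > 0. *)
Lemma exp_sq_ge (z : R) : (1 + z ^ 2 / 2) ^ 2 <= exp (z ^ 2).
Proof.
replace (z ^ 2) with (z ^ 2 / 2 + z ^ 2 / 2) at 2 by field. rewrite exp_plus.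
pose proof (exp_ineq1_le (z ^ 2 / 2)). pose proof (pow2_ge_0 z). nra.
Qed.

Lemma exp_neg_sq_le_3 (z : R) : 0 < z -> exp (- z ^ 2) <= 2 / z ^ 3.
Proof.
intros Hz. pose proof (pow_lt z 3 Hz) as H3. rewrite exp_Ropp.
replace (2 / z ^ 3) with (/ (z ^ 3 / 2)) by (field; lra).
apply Rinv_le_contravar; [lra|].
pose proof (exp_sq_ge z).
nra.
Qed.

Lemma exp_neg_sq_le_4 (z : R) : 0 < z -> exp (- z ^ 2) <= 4 / z ^ 4.
Proof.
intros Hz. pose proof (pow_lt z 4 Hz) as H4. rewrite exp_Ropp.
replace (4 / z ^ 4) with (/ (z ^ 4 / 4)) by (field; lra).
apply Rinv_le_contravar; [lra|].
pose proof (exp_sq_ge z).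
pose proof (pow2_ge_0 z). nra.
Qed.

Lemma exp_half_split (u : R) :
  exp u = exp (u / 2) ^ 2 /\ exp (- u) = / exp (u / 2) ^ 2 /\
  sech_weight u = / (exp (u / 2) + / exp (u / 2)).
Proof.
pose proof (exp_pos (u / 2)). split; [|split].
- replace u with (u / 2 + u / 2) at 1 by field. rewrite exp_plus. ring.
- rewrite exp_Ropp. f_equal. replace u with (u / 2 + u / 2) at 1 by field. rewrite exp_plus. ring.
- unfold sech_weight. now rewrite exp_Ropp.
Qed.

(** Origin of the weight: with E = e^(u/2), one bound controls u -> +oo, the other u -> -oo, and
    adding them gives 1 / (E + 1/E). *)
Lemma le_div_sum (T D E : R) :
  0 < E -> T * E <= D -> T * / E <= D -> T <= 2 * D * / (E + / E).
Proof.
intros HE H1 H2. pose proof (Rinv_0_lt_compat E HE).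
apply Rmult_le_reg_r with (E + / E); [lra|].
rewrite Rmult_assoc, Rinv_l by lra. lra.
Qed.

Lemma inv_pow_le (m : R) : 1 <= m -> / m ^ 4 <= / m ^ 3.
Proof.
intros Hm. apply Rinv_le_contravar; [apply pow_lt; lra|].
replace (m ^ 4) with (m * m ^ 3) by ring. pose proof (pow_lt m 3 ltac:(lra)). nra.
Qed.

Lemma sqrt_S_ge_1 (i : nat) : 1 <= sqrt (INR (S i)).
Proof.
rewrite <- sqrt_1. apply sqrt_le_1_alt. rewrite S_INR. pose proof (pos_INR i). lra.
Qed.

(** With g^2 = c and m, n the square roots of the indices, the exponents are the squares of g m E
    and g n / E. Bounding one factor by a fourth and the other by a third inverse power leaves 1/E
    or E; the constant is 2 * 4 * 2 over g^(4+3). *)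
Lemma exp_kernel_le (c : R) : 0 < c -> exists B, 0 <= B /\ forall u i j,
  exp (- (INR (S i) * (c * exp u))) * exp (- (INR (S j) * (c * exp (- u))))
  <= B * sech_weight u * (pow32_inv i * pow32_inv j).
Proof.
intros Hc. set (g := sqrt c). assert (Hg : 0 < g) by now apply sqrt_lt_R0.
assert (Eg : g ^ 2 = c) by (apply pow2_sqrt; lra).
pose proof (pow_lt g 7 Hg) as Hg7.
exists (16 / g ^ 7). split; [left; apply Rdiv_lt_0_compat; lra|].
intros u i j. destruct (exp_half_split u) as [E1 [E2 E3]]. rewrite E1, E2, E3.
set (E := exp (u / 2)). assert (HE : 0 < E) by apply exp_pos.
unfold pow32_inv. set (m := sqrt (INR (S i))). set (n := sqrt (INR (S j))).
assert (Hm : 1 <= m) by apply sqrt_S_ge_1. assert (Hn : 1 <= n) by apply sqrt_S_ge_1.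
replace (INR (S i) * (c * E ^ 2)) with ((g * m * E) ^ 2).
2:{ rewrite !Rpow_mult_distr, Eg. unfold m. rewrite pow2_sqrt by apply pos_INR. ring. }
replace (INR (S j) * (c * / E ^ 2)) with ((g * n * / E) ^ 2).
2:{ rewrite !Rpow_mult_distr, Eg. unfold n. rewrite pow2_sqrt by apply pos_INR.
    rewrite pow_inv. ring. }
pose proof (Rinv_0_lt_compat E HE) as HE'.
assert (Hz : 0 < g * m * E) by (repeat apply Rmult_lt_0_compat; lra).
assert (Hw : 0 < g * n * / E) by (repeat apply Rmult_lt_0_compat; lra).
pose proof (exp_neg_sq_le_3 _ Hz). pose proof (exp_neg_sq_le_4 _ Hz).
pose proof (exp_neg_sq_le_3 _ Hw). pose proof (exp_neg_sq_le_4 _ Hw).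
pose proof (exp_pos (- (g * m * E) ^ 2)). pose proof (exp_pos (- (g * n * / E) ^ 2)).
set (X := exp (- (g * m * E) ^ 2)) in *. set (Y := exp (- (g * n * / E) ^ 2)) in *.
pose proof (pow_lt m 3 ltac:(lra)). pose proof (pow_lt n 3 ltac:(lra)).
pose proof (inv_pow_le m Hm). pose proof (inv_pow_le n Hn).
pose proof (Rinv_0_lt_compat _ Hg7).
assert (Hb : 0 < / m ^ 3) by now apply Rinv_0_lt_compat.
assert (Hb' : 0 < / n ^ 3) by now apply Rinv_0_lt_compat.
replace (16 / g ^ 7 * / (E + / E) * (/ m ^ 3 * / n ^ 3))
  with (2 * (8 * / g ^ 7 * (/ m ^ 3 * / n ^ 3)) * / (E + / E)) by (unfold Rdiv; ring).
apply le_div_sum; [exact HE| |].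
- apply Rle_trans with (4 / (g * m * E) ^ 4 * (2 / (g * n * / E) ^ 3) * E).
  + apply Rmult_le_compat_r; [lra|]. apply Rmult_le_compat; lra.
  + replace (4 / (g * m * E) ^ 4 * (2 / (g * n * / E) ^ 3) * E)
      with (8 * / g ^ 7 * (/ m ^ 4 * / n ^ 3)) by (field; lra).
    apply Rmult_le_compat_l; [lra|]. apply Rmult_le_compat_r; lra.
- apply Rle_trans with (2 / (g * m * E) ^ 3 * (4 / (g * n * / E) ^ 4) * / E).
  + apply Rmult_le_compat_r; [lra|]. apply Rmult_le_compat; lra.
  + replace (2 / (g * m * E) ^ 3 * (4 / (g * n * / E) ^ 4) * / E)
      with (8 * / g ^ 7 * (/ m ^ 3 * / n ^ 4)) by (field; lra).
    apply Rmult_le_compat_l; [lra|]. apply Rmult_le_compat_l; lra.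
Qed.

(** The first bound drops y^2 = z^4 from the denominator. The second, half a power weaker in k^2,
    uses z^4 + k^4 >= z k^3, by comparing z with k. *)
Lemma pf_le_aux (z k V : R) :
  0 < z -> 0 < k -> k ^ 2 <= 2 * PI * V ->
  pf (z ^ 2) V <= 2 * z ^ 2 / k ^ 4 /\ pf (z ^ 2) V <= 2 * z / k ^ 3.
Proof.
intros Hz Hk HV. unfold pf.
assert (HVV : k ^ 4 <= (2 * PI * V) ^ 2).
{ replace (k ^ 4) with ((k ^ 2) ^ 2) by ring. apply pow_incr. split; [apply pow2_ge_0|exact HV]. }
pose proof (pow_lt z 2 Hz) as Hz2. pose proof (pow_lt k 3 Hk) as Hk3. pose proof (pow_lt k 4 Hk) as Hk4.
pose proof (pow_lt (z ^ 2) 2 Hz2) as Hz4.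
set (W := (2 * PI * V) ^ 2) in *.
split.
- apply Rmult_le_compat_l; [lra|]. apply Rinv_le_contravar; lra.
- replace (2 * z / k ^ 3) with (2 * z ^ 2 * / (z * k ^ 3)) by (field; lra).
  apply Rmult_le_compat_l; [lra|]. apply Rinv_le_contravar; [nra|].
  apply Rle_trans with (z ^ 4 + k ^ 4); [|replace ((z ^ 2) ^ 2) with (z ^ 4) by ring; lra].
  destruct (Rle_dec z k) as [L|L].
  + assert (z * k ^ 3 <= k * k ^ 3) by (apply Rmult_le_compat_r; lra).
    pose proof (pow_lt z 4 Hz). lra.
  + assert (k ^ 3 <= z ^ 3) by (apply pow_incr; lra).
    assert (z * k ^ 3 <= z * z ^ 3) by (apply Rmult_le_compat_l; lra). lra.
Qed.

(** Pairing the two bounds of [pf_le_aux] crosswise leaves 1/E or E, as for the exponential kernel.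
    The factor s^4 t^4 absorbs the moduli and 8 = 2 * 2 * 2. *)
Lemma pf_kernel_le (c : R) (p q : nat) : 0 < c -> (1 <= p)%nat -> (1 <= q)%nat ->
  exists B, 0 <= B /\ forall u i j,
  pf (c * exp u) (INR (S i) / INR p) * pf (c * exp (- u)) (INR (S j) / INR q)
  <= B * sech_weight u * (pow32_inv i * pow32_inv j).
Proof.
intros Hc Hp Hq. set (g := sqrt c). assert (Hg : 0 < g) by now apply sqrt_lt_R0.
assert (Eg : g ^ 2 = c) by (apply pow2_sqrt; lra).
pose proof (pow_lt g 3 Hg) as Hg3.
set (s := sqrt (INR p)). set (t := sqrt (INR q)).
assert (Es : s ^ 2 = INR p) by apply pow2_sqrt, pos_INR.
assert (Et : t ^ 2 = INR q) by apply pow2_sqrt, pos_INR.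
assert (Hs : 1 <= s) by (destruct p; [lia|apply sqrt_S_ge_1]).
assert (Ht : 1 <= t) by (destruct q; [lia|apply sqrt_S_ge_1]).
assert (Hst : 0 < s ^ 4 * t ^ 4) by (apply Rmult_lt_0_compat; apply pow_lt; lra).
exists (8 * g ^ 3 * (s ^ 4 * t ^ 4)). split; [left; repeat apply Rmult_lt_0_compat; nra|].
intros u i j. destruct (exp_half_split u) as [E1 [E2 E3]]. rewrite E1, E2, E3.
set (E := exp (u / 2)). assert (HE : 0 < E) by apply exp_pos.
pose proof (Rinv_0_lt_compat E HE) as HE'.
unfold pow32_inv. set (m := sqrt (INR (S i))). set (n := sqrt (INR (S j))).
assert (Hm : 1 <= m) by apply sqrt_S_ge_1. assert (Hn : 1 <= n) by apply sqrt_S_ge_1.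
assert (Em : m ^ 2 = INR (S i)) by apply pow2_sqrt, pos_INR.
assert (En : n ^ 2 = INR (S j)) by apply pow2_sqrt, pos_INR.
replace (c * E ^ 2) with ((g * E) ^ 2) by (rewrite Rpow_mult_distr, Eg; ring).
replace (c * / E ^ 2) with ((g * / E) ^ 2) by (rewrite Rpow_mult_distr, Eg, pow_inv; ring).
rewrite <- Em, <- En, <- Es, <- Et.
assert (HPI : 1 <= 2 * PI) by (pose proof PI2_1; lra).
assert (Hz : 0 < g * E) by nra. assert (Hw : 0 < g * / E) by nra.
assert (Hk : 0 < m / s) by (apply Rdiv_lt_0_compat; lra).
assert (Hl : 0 < n / t) by (apply Rdiv_lt_0_compat; lra).
assert (Hkk : (m / s) ^ 2 <= 2 * PI * (m ^ 2 / s ^ 2)).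
{ replace (m ^ 2 / s ^ 2) with ((m / s) ^ 2) by (field; lra).
  pose proof (pow2_ge_0 (m / s)). nra. }
assert (Hll : (n / t) ^ 2 <= 2 * PI * (n ^ 2 / t ^ 2)).
{ replace (n ^ 2 / t ^ 2) with ((n / t) ^ 2) by (field; lra).
  pose proof (pow2_ge_0 (n / t)). nra. }
destruct (pf_le_aux (g * E) (m / s) (m ^ 2 / s ^ 2) Hz Hk Hkk) as [A1 A2].
destruct (pf_le_aux (g * / E) (n / t) (n ^ 2 / t ^ 2) Hw Hl Hll) as [B1 B2].
pose proof (pf_pos ((g * E) ^ 2) (m ^ 2 / s ^ 2) (pow_lt _ 2 Hz)).
pose proof (pf_pos ((g * / E) ^ 2) (n ^ 2 / t ^ 2) (pow_lt _ 2 Hw)).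
set (X := pf ((g * E) ^ 2) (m ^ 2 / s ^ 2)) in *.
set (Y := pf ((g * / E) ^ 2) (n ^ 2 / t ^ 2)) in *.
pose proof (inv_pow_le m Hm). pose proof (inv_pow_le n Hn).
assert (Hb : 0 < / m ^ 3) by (apply Rinv_0_lt_compat, pow_lt; lra).
assert (Hb' : 0 < / n ^ 3) by (apply Rinv_0_lt_compat, pow_lt; lra).
assert (Hb4 : 0 < / m ^ 4) by (apply Rinv_0_lt_compat, pow_lt; lra).
assert (Hb4' : 0 < / n ^ 4) by (apply Rinv_0_lt_compat, pow_lt; lra).
assert (Hst' : s ^ 4 * t ^ 3 <= s ^ 4 * t ^ 4 /\ s ^ 3 * t ^ 4 <= s ^ 4 * t ^ 4).
{ pose proof (pow_lt s 3 ltac:(lra)). pose proof (pow_lt t 3 ltac:(lra)).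
  pose proof (pow_lt s 4 ltac:(lra)). pose proof (pow_lt t 4 ltac:(lra)).
  split.
  - apply Rmult_le_compat_l; [lra|]. replace (t ^ 4) with (t * t ^ 3) by ring. nra.
  - apply Rmult_le_compat_r; [lra|]. replace (s ^ 4) with (s * s ^ 3) by ring. nra. }
replace (8 * g ^ 3 * (s ^ 4 * t ^ 4) * / (E + / E) * (/ m ^ 3 * / n ^ 3))
  with (2 * (4 * g ^ 3 * ((s ^ 4 * t ^ 4) * (/ m ^ 3 * / n ^ 3))) * / (E + / E)) by ring.
assert (0 < s ^ 4 * t ^ 3) by (apply Rmult_lt_0_compat; apply pow_lt; lra).
assert (0 < s ^ 3 * t ^ 4) by (apply Rmult_lt_0_compat; apply pow_lt; lra).
apply le_div_sum; [exact HE| |].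
- apply Rle_trans with (2 * (g * E) / (m / s) ^ 3 * (2 * (g * / E) ^ 2 / (n / t) ^ 4) * E).
  + apply Rmult_le_compat_r; [lra|]. apply Rmult_le_compat; lra.
  + replace (2 * (g * E) / (m / s) ^ 3 * (2 * (g * / E) ^ 2 / (n / t) ^ 4) * E)
      with (4 * g ^ 3 * ((s ^ 3 * t ^ 4) * (/ m ^ 3 * / n ^ 4))) by (field; lra).
    apply Rmult_le_compat_l; [lra|]. apply Rmult_le_compat; [lra|nra|lra|].
    apply Rmult_le_compat_l; lra.
- apply Rle_trans with (2 * (g * E) ^ 2 / (m / s) ^ 4 * (2 * (g * / E) / (n / t) ^ 3) * / E).
  + apply Rmult_le_compat_r; [lra|]. apply Rmult_le_compat; lra.
  + replace (2 * (g * E) ^ 2 / (m / s) ^ 4 * (2 * (g * / E) / (n / t) ^ 3) * / E)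
      with (4 * g ^ 3 * ((s ^ 4 * t ^ 3) * (/ m ^ 4 * / n ^ 3))) by (field; lra).
    apply Rmult_le_compat_l; [lra|]. apply Rmult_le_compat; [lra|nra|lra|].
    apply Rmult_le_compat_r; lra.
Qed.

(** * Divisor sums as integrals *)

(** The value [h] depends on the product of the indices alone, which lets the pairs be collected
    into a divisor sum. *)
Lemma line_integral_dchi (c1 c2 : nat -> C) (phi psi : nat -> R -> R) (h : nat -> R) (N : nat) :
  (forall i j, line_integral (fun u => phi i u * psi j u) (h (S i * S j)%nat)) ->
  line_integral_C
    (fun u => hyperbola_sum N (fun i j =>
       (c1 (S i) * RtoC (phi i u)) * (c2 (S j) * RtoC (psi j u)))%C)
    (csum (fun n => dchi c1 c2 (S n) * RtoC (h (S n)))%C N).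
Proof.
intros H. rewrite (csum_dchi c1 c2 (fun n => RtoC (h n))).
apply line_integral_C_csum. intros i _. apply line_integral_C_csum. intros j _.
destruct (S i * S j <=? N)%nat; [|apply line_integral_C_0].
apply (line_integral_C_ext (fun u => c1 (S i) * c2 (S j) * RtoC (phi i u * psi j u))%C).
- intros u. rewrite RtoC_mult. ring.
- apply line_integral_C_scal, H.
Qed.

Lemma hyperbola_kernel_approx (c1 c2 : nat -> C) (phi psi : nat -> R -> R) (F G : R -> C)
  (p q : nat) (B u : R) (N : nat) :
  (1 <= p)%nat -> (1 <= q)%nat -> (1 <= N)%nat -> 0 <= B ->
  (forall n, Cmod (c1 n) <= 1) -> (forall n, Cmod (c2 n) <= 1) ->
  (forall i, 0 < phi i u) -> (forall j, 0 < psi j u) ->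
  clim (fun k => csum (fun i => c1 (S i) * RtoC (phi i u))%C (p * k)) (F u) ->
  clim (fun k => csum (fun j => c2 (S j) * RtoC (psi j u))%C (q * k)) (G u) ->
  (forall i j, phi i u * psi j u <= B * sech_weight u * (pow32_inv i * pow32_inv j)) ->
  Cmod (F u * G u - hyperbola_sum N (fun i j =>
       (c1 (S i) * RtoC (phi i u)) * (c2 (S j) * RtoC (psi j u))))%C
  <= B * hyperbola_error N * sech_weight u.
Proof.
intros Hp Hq HN HB H1 H2 Hphi Hpsi HF HG H.
replace (B * hyperbola_error N * sech_weight u)
  with (B * sech_weight u * hyperbola_error N) by ring.
apply (hyperbola_approx _ _ _ _ p q); try assumption.
- apply Rmult_le_pos; [exact HB|left; apply sech_weight_pos].
- intros i j. eapply Rle_trans; [|apply H].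
  rewrite !Cmod_mult, !Cmod_R, !Rabs_pos_eq by (left; apply Hphi || apply Hpsi).
  specialize (H1 (S i)). specialize (H2 (S j)). specialize (Hphi i). specialize (Hpsi j).
  pose proof (Cmod_ge_0 (c1 (S i))). pose proof (Cmod_ge_0 (c2 (S j))).
  apply Rmult_le_compat; nra.
Qed.

Lemma hyperbola_error_pos (N : nat) : (1 <= N)%nat -> 0 <= hyperbola_error N.
Proof.
intros HN. eapply Rle_trans; [|apply (hyperbola_tail N 0 0 HN)]. simpl. lra.
Qed.

(** [P] is only a pointwise intermediary: the triangle inequality through it bounds H1 - H2, and
    that difference is what is integrated. *)
Lemma line_integral_C_near (H1 H2 P : R -> C) (V1 V2 : C) (B1 B2 : R) :
  0 <= B1 -> 0 <= B2 -> line_integral_C H1 V1 -> line_integral_C H2 V2 ->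
  (forall u, Cmod (P u - H1 u)%C <= B1 * sech_weight u) ->
  (forall u, Cmod (P u - H2 u)%C <= B2 * sech_weight u) ->
  Cmod (V1 - V2)%C <= 16 * (B1 + B2).
Proof.
intros HB1 HB2 I1 I2 A1 A2.
apply (line_integral_C_le (fun u => H1 u - H2 u)%C); [lra|now apply line_integral_C_minus|].
intros u. replace (H1 u - H2 u)%C with (- (P u - H1 u) + (P u - H2 u))%C by ring.
eapply Rle_trans; [apply Cmod_triangle|]. rewrite Cmod_opp.
specialize (A1 u). specialize (A2 u). lra.
Qed.

Lemma clim_incr_1 (u : nat -> C) (l : C) : clim (fun n => u (S n)) l -> clim u l.
Proof. intros H. apply is_lim_seq_incr_1. exact H. Qed.

(** Replaces dominated convergence. Comparing two levels of [H2] through [P] shows that [V2] is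
    Cauchy; comparing [H1] with kappa [H2] at one level through kappa [P] transfers the limit to
    [V1]. *)
Lemma line_integral_limits (H1 H2 : nat -> R -> C) (P : R -> C) (V1 V2 : nat -> C)
  (kappa : C) (B1 B2 : R) :
  0 <= B1 -> 0 <= B2 ->
  (forall N, line_integral_C (H1 N) (V1 N)) -> (forall N, line_integral_C (H2 N) (V2 N)) ->
  (forall N u, (1 <= N)%nat ->
     Cmod (kappa * P u - H1 N u)%C <= B1 * hyperbola_error N * sech_weight u) ->
  (forall N u, (1 <= N)%nat ->
     Cmod (P u - H2 N u)%C <= B2 * hyperbola_error N * sech_weight u) ->
  exists l, clim V1 (kappa * l)%C /\ clim V2 l.
Proof.
intros HB1 HB2 I1 I2 A1 A2.
(* Shifted by one because [hyperbola_error 0] divides by zero. *)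
set (e := fun n => hyperbola_error (S n)).
assert (He0 : forall n, 0 <= e n) by (intros; apply hyperbola_error_pos; lia).
assert (He : is_lim_seq e 0) by (apply (is_lim_seq_incr_1 hyperbola_error), is_lim_hyperbola_error).
assert (Hscal : forall k, is_lim_seq (fun n => k * e n) 0).
{ intros k. replace (Finite 0) with (Rbar_mult k 0) by (simpl; f_equal; ring).
  now apply is_lim_seq_scal_l. }
destruct (clim_cauchy (fun n => V2 (S n)) (fun n => 16 * B2 * e n)) as [l Hl]; [|apply Hscal|].
{ intros n m.
  replace (16 * B2 * e n + 16 * B2 * e m) with (16 * (B2 * e n + B2 * e m)) by ring.
  apply (line_integral_C_near (H2 (S n)) (H2 (S m)) P); try apply I2;
    try (apply Rmult_le_pos; [exact HB2|apply He0]); intros u; apply A2; lia. }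
exists l. split; [|now apply clim_incr_1]. apply clim_incr_1.
pose proof (Cmod_ge_0 kappa) as Hk.
apply (clim_ext (fun n => (V1 (S n) - kappa * V2 (S n)) + kappa * V2 (S n))%C); [intros; ring|].
replace (kappa * l)%C with (RtoC 0 + kappa * l)%C by ring.
apply clim_plus; [|now apply clim_mult_l].
apply (clim_squeeze _ _ (fun n => 16 * (B1 + Cmod kappa * B2) * e n)); [|apply Hscal].
intros n. replace (V1 (S n) - kappa * V2 (S n) - 0)%C with (V1 (S n) - kappa * V2 (S n))%C by ring.
replace (16 * (B1 + Cmod kappa * B2) * e n)
  with (16 * (B1 * e n + Cmod kappa * B2 * e n)) by ring.
apply (line_integral_C_near (H1 (S n)) (fun u => kappa * H2 (S n) u)%C (fun u => kappa * P u)%C).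
- apply Rmult_le_pos; [exact HB1|apply He0].
- apply Rmult_le_pos; [|apply He0]. now apply Rmult_le_pos.
- apply I1.
- apply line_integral_C_mult, I2.
- intros u. apply A1. lia.
- intros u. replace (kappa * P u - kappa * H2 (S n) u)%C with (kappa * (P u - H2 (S n) u))%C by ring.
  rewrite Cmod_mult, !Rmult_assoc. apply Rmult_le_compat_l; [exact Hk|].
  rewrite <- Rmult_assoc. apply A2. lia.
Qed.

Theorem theorem2p14 (p q : nat) (chi1 chi2 : nat -> C) (a x : R) :
  primitive_char p chi1 -> even_char p chi1 -> ~ principal p chi1 ->
  primitive_char q chi2 -> even_char q chi2 -> ~ principal q chi2 ->
  0 < a -> 0 < x ->
  (forall m : nat, (0 < m)%nat ->
     a ^ 2 * INR p * INR q * x / (16 * PI ^ 2) <> INR m) ->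
  exists L M : C,
    is_series (fun n : nat =>
      (dchi chi1 chi2 (S n) * RtoC (K0 (a * sqrt (INR (S n) * x))))%C) L /\
    is_series (fun n : nat =>
      (dchi (conj_char chi1) (conj_char chi2) (S n) *
       RtoC (ln (16 * PI ^ 2 * INR (S n) / (a ^ 2 * INR p * INR q * x)) /
             (INR (S n) ^ 2 - (a ^ 2 * INR p * INR q * x / (16 * PI ^ 2)) ^ 2)))%C) M /\
    L = (RtoC (a ^ 2 * INR p * INR q * x / (32 * PI ^ 4))
         * gauss_sum p chi1 * gauss_sum q chi2 * M)%C.
Proof.
intros Hprim1 He1 Hn1 Hprim2 He2 Hn2 Ha Hx Hne.
pose proof Hprim1 as [Hc1 _]. pose proof Hprim2 as [Hc2 _].
pose proof (nonprincipal_gt_1 p chi1 Hc1 Hn1) as Hp.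
pose proof (nonprincipal_gt_1 q chi2 Hc2 Hn2) as Hq.
assert (HIp : 0 < INR p) by (apply lt_0_INR; lia).
assert (HIq : 0 < INR q) by (apply lt_0_INR; lia).
pose proof PI_RGT_0 as HPI.
pose proof (sqrt_lt_R0 x Hx) as Hsx.
assert (Esx : sqrt x ^ 2 = x) by (apply pow2_sqrt; lra).
set (c := a * sqrt x / 2). assert (Hc : 0 < c) by (unfold c; nra).
assert (Ec : c ^ 2 = a ^ 2 * x / 4) by (rewrite <- Esx; unfold c; field).
set (beta := a ^ 2 * INR p * INR q * x / (16 * PI ^ 2)) in *.
assert (Ebeta : beta = c ^ 2 * INR p * INR q / (4 * PI ^ 2)).
{ unfold beta. rewrite Ec. field. lra. }
assert (Hc2' : 0 < c ^ 2) by now apply pow_lt.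
assert (HPI2 : 0 < PI ^ 2) by now apply pow_lt.
assert (Hbeta : 0 < beta).
{ rewrite Ebeta. apply Rdiv_lt_0_compat; [|lra]. apply Rmult_lt_0_compat; [apply Rmult_lt_0_compat|]; assumption. }
set (T := fun n : nat => ln (16 * PI ^ 2 * INR n / (a ^ 2 * INR p * INR q * x)) /
             (INR n ^ 2 - beta ^ 2)).
(* The factor between [T] and the logarithmic integral: 4 pi^2 mn / (pq) equals c^2 mn / beta, so
   the denominator there is (c^4 / beta^2) ((mn)^2 - beta^2). *)
set (k := 4 * beta ^ 2 / c ^ 2).
assert (Hline : forall i j, line_integral
   (fun u => pf (c * exp u) (INR (S i) / INR p) * pf (c * exp (- u)) (INR (S j) / INR q))
   (k * T (S i * S j)%nat)).
{ intros i j.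
  assert (HSi : 0 < INR (S i)) by (apply lt_0_INR; lia).
  assert (HSj : 0 < INR (S j)) by (apply lt_0_INR; lia).
  assert (En : 4 * PI ^ 2 * (INR (S i) / INR p * (INR (S j) / INR q))
               = c ^ 2 * (INR (S i * S j) / beta)).
  { rewrite Ebeta, mult_INR. field. repeat split; lra. }
  (* The exclusion of positive integer values of [beta] keeps every denominator of [T] away from
     0. *)
  assert (Hnn : INR (S i * S j) <> beta) by (intros E; apply (Hne (S i * S j)%nat); [lia|now symmetry]).
  assert (Hn0 : 0 < INR (S i * S j)) by (apply lt_0_INR; lia).
  assert (HT : k * T (S i * S j)%nat
    = 4 * c ^ 2 * ln (4 * PI ^ 2 * (INR (S i) / INR p * (INR (S j) / INR q)) / c ^ 2)
      / ((4 * PI ^ 2 * (INR (S i) / INR p * (INR (S j) / INR q))) ^ 2 - c ^ 4)).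
  { rewrite En. unfold T, k.
    replace (16 * PI ^ 2 * INR (S i * S j) / (a ^ 2 * INR p * INR q * x))
      with (INR (S i * S j) / beta) by (unfold beta; field; repeat split; lra).
    replace (c ^ 2 * (INR (S i * S j) / beta) / c ^ 2) with (INR (S i * S j) / beta)
      by (field; lra).
    assert ((INR (S i * S j)) ^ 2 - beta ^ 2 <> 0).
    { replace (INR (S i * S j) ^ 2 - beta ^ 2)
        with ((INR (S i * S j) - beta) * (INR (S i * S j) + beta)) by ring.
      apply Rmult_integral_contrapositive_currified; lra. }
    set (n := INR (S i * S j)) in *. set (l := ln (n / beta)).
    replace ((c ^ 2 * (n / beta)) ^ 2 - c ^ 4) with (c ^ 4 / beta ^ 2 * (n ^ 2 - beta ^ 2))
      by (field; lra).
    field. repeat split; lra. }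
  rewrite HT. apply line_integral_pf; [exact Hc|now apply Rdiv_lt_0_compat|now apply Rdiv_lt_0_compat|].
  rewrite En. intros E. apply Hnn.
  replace (INR (S i * S j)) with (c ^ 2 * (INR (S i * S j) / beta) * beta / c ^ 2) by (field; lra).
  rewrite E. field. lra. }
assert (HlineA : forall i j, line_integral
   (fun u => exp (- (INR (S i) * (c * exp u))) * exp (- (INR (S j) * (c * exp (- u)))))
   (2 * K0 (2 * c * sqrt (INR (S i * S j))))).
{ intros i j. rewrite mult_INR.
  apply line_integral_bessel; [exact Hc|apply lt_0_INR; lia|apply lt_0_INR; lia]. }
destruct (exp_kernel_le c Hc) as [BA [HBA BoundA]].
destruct (pf_kernel_le c p q Hc ltac:(lia) ltac:(lia)) as [BB [HBB BoundB]].
set (kappa := (gauss_sum p chi1 / RtoC (INR p) * (gauss_sum q chi2 / RtoC (INR q)))%C).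
assert (Hconj : forall m (chi : nat -> C), dirichlet_char m chi -> forall n, Cmod (conj_char chi n) <= 1).
{ intros m chi H n. unfold conj_char. rewrite Cmod_conj. now apply (char_Cmod_le_1 m). }
assert (Hy : forall u, 0 < c * exp u) by (intros u; pose proof (exp_pos u); nra).
destruct (line_integral_limits _ _
   (fun u => char_pf_limit p chi1 (c * exp u) * char_pf_limit q chi2 (c * exp (- u)))%C
   _ _ kappa BA BB HBA HBB
   (fun N => line_integral_dchi chi1 chi2
      (fun i u => exp (- (INR (S i) * (c * exp u)))) (fun j u => exp (- (INR (S j) * (c * exp (- u)))))
      (fun n => 2 * K0 (2 * c * sqrt (INR n))) N HlineA)
   (fun N => line_integral_dchi (conj_char chi1) (conj_char chi2)
      (fun i u => pf (c * exp u) (INR (S i) / INR p)) (fun j u => pf (c * exp (- u)) (INR (S j) / INR q))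
      (fun n => k * T n) N Hline)) as [l [HL HM]].
- intros N u HN.
  replace (kappa * (char_pf_limit p chi1 (c * exp u) * char_pf_limit q chi2 (c * exp (- u))))%C
    with (char_exp_limit p chi1 (c * exp u) * char_exp_limit q chi2 (c * exp (- u)))%C.
  2:{ rewrite (char_exp_limit_eq p), (char_exp_limit_eq q) by (assumption || apply Hy).
      unfold kappa. ring. }
  apply (hyperbola_kernel_approx chi1 chi2
     (fun i u => exp (- (INR (S i) * (c * exp u)))) (fun j u => exp (- (INR (S j) * (c * exp (- u)))))
     (fun u => char_exp_limit p chi1 (c * exp u)) (fun u => char_exp_limit q chi2 (c * exp (- u))) p q);
     try lia; try exact HBA.
  + intros n. now apply (char_Cmod_le_1 p).
  + intros n. now apply (char_Cmod_le_1 q).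
  + intros; apply exp_pos.
  + intros; apply exp_pos.
  + apply clim_char_exp; [exact Hc1|exact Hp|apply Hy].
  + apply clim_char_exp; [exact Hc2|exact Hq|apply Hy].
  + intros; apply BoundA.
- intros N u HN.
  apply (hyperbola_kernel_approx (conj_char chi1) (conj_char chi2)
     (fun i u => pf (c * exp u) (INR (S i) / INR p)) (fun j u => pf (c * exp (- u)) (INR (S j) / INR q))
     (fun u => char_pf_limit p chi1 (c * exp u)) (fun u => char_pf_limit q chi2 (c * exp (- u))) p q);
     try lia; try exact HBB.
  + now apply (Hconj p).
  + now apply (Hconj q).
  + intros; apply pf_pos, Hy.
  + intros; apply pf_pos, Hy.
  + apply clim_char_pf; [exact Hc1|exact Hp|apply Hy].
  + apply clim_char_pf; [exact Hc2|exact Hq|apply Hy].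
  + intros; apply BoundB.
- assert (Hk : 0 < k) by (unfold k; apply Rdiv_lt_0_compat; [pose proof (pow_lt beta 2 Hbeta)|]; lra).
  (* The factor 1/2 undoes the 2 in [2 * K0], and 1/k undoes the [k] in [k * T n]. *)
  exists (RtoC (/ 2) * (kappa * l))%C, (RtoC (/ k) * l)%C. split; [|split].
  + apply clim_is_series.
    eapply clim_ext; [|apply (clim_mult_l (RtoC (/ 2))); exact HL].
    intros N. cbv beta. rewrite <- csum_mult_l. apply csum_ext. intros n _.
    replace (a * sqrt (INR (S n) * x)) with (2 * c * sqrt (INR (S n))).
    2:{ rewrite sqrt_mult by (try apply pos_INR; lra). unfold c. field. }
    set (d := dchi chi1 chi2 (S n)). set (K := K0 (2 * c * sqrt (INR (S n)))).
    replace (RtoC K) with (RtoC (/ 2 * (2 * K))) by (f_equal; field).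
    rewrite (RtoC_mult (/ 2)). ring.
  + apply clim_is_series.
    eapply clim_ext; [|apply (clim_mult_l (RtoC (/ k))); exact HM].
    intros N. cbv beta. rewrite <- csum_mult_l. apply csum_ext. intros n _.
    fold (T (S n)). set (d := dchi (conj_char chi1) (conj_char chi2) (S n)).
    replace (RtoC (T (S n))) with (RtoC (/ k * (k * T (S n)))) by (f_equal; field; lra).
    rewrite (RtoC_mult (/ k)). ring.
  (* k / (2pq) = 2 beta^2 / (c^2 pq) = c^2 pq / (8 pi^4), and c^2 = a^2 x / 4. *)
  + replace (a ^ 2 * INR p * INR q * x / (32 * PI ^ 4)) with (/ 2 * (k * (/ INR p * / INR q))).
    2:{ unfold k. rewrite Ebeta.
        replace (a ^ 2 * INR p * INR q * x) with (4 * c ^ 2 * INR p * INR q) by (rewrite Ec; field).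
        field. repeat split; lra. }
    assert (Nk : RtoC k <> RtoC 0) by (intros D; injection D as D; lra).
    assert (Np : RtoC (INR p) <> RtoC 0) by (intros D; injection D as D; lra).
    assert (Nq : RtoC (INR q) <> RtoC 0) by (intros D; injection D as D; lra).
    rewrite !RtoC_mult, !RtoC_inv by lra. unfold kappa. field.
    repeat split; assumption.
Qed.
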